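(* Let $F:M\to M$, $F(b,x)=(Ab,f_b(x))$, be a boundary preserving skew product on $M=\mathbb{T}^d\times[0,1]$ as in the context, with each $f_b$ of class $C^2$ in $x$, and suppose there are constants $C_2,\beta>0$ with $\|f_b-f_{b'}\|_{C^2}\le C_2\|b-b'\|^{\beta}$ for all $b,b'\in\mathbb{T}^d$. Put $\lambda_b=f_b'(0)$, $F_0(b,x)=(Ab,\lambda_b x)$, let $\mu$ be the largest modulus of an eigenvalue of $A$, and suppose that $$\lambda_b\le q<1\qquad\text{for all } b\in\mathbb{T}^d .$$ Then there exist $\varepsilon>0$ and a continuous fiber preserving map $H$, defined on $$M_\varepsilon=\{(b,x)\in\mathbb{T}^d\times[0,1] : x\in[0,\varepsilon]\},$$ which is a homeomorphism onto its image in $M$, of the form $H(b,x)=(b,x+h_b(x))$ with $h_b(0)=\frac{\partial h_b}{\partial x}(0)=0$ and $h_b$ continuous in $x$, such that $$F\circ H=H\circ F_0\quad\text{on } M_\varepsilon,$$ and such that for every $\alpha$ with $0<\alpha<\min(\beta,-\log_\mu q)$ there is a constant $\tilde C_0>0$ with $$\sup_{x\in[0,\varepsilon]}|h_b(x)-h_{b'}(x)|\le\tilde C_0\|b-b'\|^{\alpha}\qquad\text{for all } b,b'\in\mathbb{T}^d .$$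
   Context: $\mathbb{T}^d=\mathbb{R}^d/\mathbb{Z}^d$, and $\|b-b'\|$ denotes the distance on $\mathbb{T}^d$. A boundary preserving skew product is a map $F:M\to M$, $M=\mathbb{T}^d\times[0,1]$, $F(b,x)=(Ab,f_b(x))$, where $A$ is a linear hyperbolic automorphism of $\mathbb{T}^d$ (induced by a matrix in $GL(d,\mathbb{Z})$ with no eigenvalue of modulus 1) and each $f_b:[0,1]\to[0,1]$ is an orientation preserving diffeomorphism with $f_b(0)=0$, $f_b(1)=1$. $C^2$-norms are taken with respect to the fiber variable $x\in[0,1]$. *)

(* Defs.v *)
From HB Require Import structures.
From mathcomp Require Import all_boot all_order all_algebra.
From mathcomp Require Import all_classical all_reals all_analysis.
From mathcomp Require Import complex.

Set Implicit Arguments.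
Unset Strict Implicit.
Unset Printing Implicit Defensive.

Import Order.TTheory GRing.Theory Num.Theory numFieldNormedType.Exports.

Local Open Scope classical_set_scope.
Local Open Scope ring_scope.
Local Open Scope quotient_scope.

Section Torus.
Variables (R : realType) (d : nat).

Definition lattice_eqv : rel 'cV[R]_d :=
  fun x y => [forall i, (x i 0 - y i 0) \is a Num.int].

Lemma lattice_eqv_is_equiv : equiv_class_of lattice_eqv.
Proof.
split=> [x|x y|y x z].
- by apply/forallP => i; rewrite subrr rpred0.
- by apply/forallP/forallP => h i; rewrite -opprB rpredN.
- move=> /forallP xy /forallP yz; apply/forallP => i.
  by rewrite -(subrKA (y i 0)) rpredD.
Qed.

Canonical lattice_equiv := EquivRelPack lattice_eqv_is_equiv.

Definition torus : Type := quotient_topology {eq_quot lattice_equiv}.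
HB.instance Definition _ := Topological.on torus.
HB.instance Definition _ := Quotient.on torus.

(* The matrix norm of the library is the sup norm. *)
Definition eucl_norm (x : 'cV[R]_d) : R := Num.sqrt (\sum_i x i 0 ^+ 2).

Definition torus_dist (b b' : torus) : R :=
  inf [set eucl_norm (x - y) | x in [set x | \pi_torus x = b]
                             & y in [set y | \pi_torus y = b']].

Definition torus_map (A : 'M[int]_d) (b : torus) : torus :=
  \pi_torus (map_mx intr A *m repr b).

Lemma torus_mapE (A : 'M[int]_d) (x : 'cV[R]_d) :
  torus_map A (\pi_torus x) = \pi_torus (map_mx intr A *m x).
Proof.
apply/eqmodP/forallP => i /=.
have /eqmodP/forallP /= xx : repr (\pi_torus x) = x %[mod torus] by rewrite reprK.
rewrite !mxE -sumrB rpred_sum// => j _; rewrite !mxE -mulrBr rpredM ?xx//.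
exact: intr_int.
Qed.

Definition complex_mx (A : 'M[int]_d) : 'M[R[i]]_d := map_mx intr A.

Definition hyperbolic (A : 'M[int]_d) : Prop :=
  A \in unitmx /\ forall z : R[i], eigenvalue (complex_mx A) z -> `|z| <> 1.

Definition is_max_eigenvalue_modulus (A : 'M[int]_d) (mu : R) : Prop :=
  (exists2 z : R[i], eigenvalue (complex_mx A) z & `|z| = mu%:C%C) /\
  (forall z : R[i], eigenvalue (complex_mx A) z -> `|z| <= mu%:C%C).

End Torus.

Section Calculus.
Variable R : realType.
Implicit Types (S : set R) (f g : R -> R).

Definition is_derive_within S f (x l : R) : Prop :=
  (fun y => (f y - f x) / (y - x)) @ within S x^' --> l.

Definition derivable_within S f (x : R) : Prop :=
  exists l, is_derive_within S f x l.

(* One-sided at the end points of an interval [S]. *)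
Definition derive_within S f (x : R) : R :=
  lim ((fun y => (f y - f x) / (y - x)) @ within S x^').

Fixpoint class_C (n : nat) S f : Prop :=
  if n is m.+1 then
    (forall x, S x -> derivable_within S f x) /\ class_C m S (derive_within S f)
  else {within S, continuous f}.

Definition sup_norm S f : \bar R := ereal_sup [set `|f x|%:E | x in S].

Definition C2_norm S f : \bar R :=
  (sup_norm S f + sup_norm S (derive_within S f)
   + sup_norm S (derive_within S (derive_within S f)))%E.

Definition unit_itv : set R := `[0, 1]%classic.

Definition orientation_preserving_diffeo f : Prop :=
  [/\ set_fun unit_itv unit_itv f,
      class_C 1 unit_itv f,
      {in unit_itv &, {homo f : x y / x < y}} &
      exists g, [/\ set_fun unit_itv unit_itv g,
        class_C 1 unit_itv g,
        {in unit_itv, cancel f g} & {in unit_itv, cancel g f}]].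

Definition log_base (mu x : R) : R := ln x / ln mu.

End Calculus.

Arguments unit_itv R : clear implicits.

Definition homeo_onto_image (X Y : topologicalType) (A : set X) (h : X -> Y) :=
  {within A, continuous h} /\
  exists g : Y -> X, {within h @` A, continuous g} /\ {in A, cancel h g}.

Section SkewProduct.
Variables (R : realType) (d : nat).

Definition strip (eps : R) : set (torus R d * R) :=
  [set p | unit_itv R p.2 /\ `[0, eps]%classic p.2].

Definition phase_space : set (torus R d * R) := [set p | unit_itv R p.2].

Definition skew_product (A : 'M[int]_d) (f : torus R d -> R -> R)
    (p : torus R d * R) : torus R d * R :=
  (torus_map A p.1, f p.1 p.2).

(* Fiber maps are total functions on [R]; only their values on [0, 1] matter. *)
Definition boundary_preserving (A : 'M[int]_d) (f : torus R d -> R -> R) :=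
  hyperbolic R A /\
  forall b, [/\ orientation_preserving_diffeo (f b), f b 0 = 0 & f b 1 = 1].

Definition fiber_multiplier (f : torus R d -> R -> R) (b : torus R d) : R :=
  derive_within (unit_itv R) (f b) 0.

Definition linearization (f : torus R d -> R -> R) (b : torus R d) (x : R) : R :=
  fiber_multiplier f b * x.

End SkewProduct.

Arguments strip {R} d eps.
Arguments phase_space R d : clear implicits.

(* Main.v *)
(** Over the base, the multiplicative cocycle [f_b x / (lambda_b x)] is a
    coboundary near the zero section: with [s_b x = ln (f_b x / (lambda_b x))],
    which is [O(x)], the sum [S_b x] of [s] along the orbit of [(b, x)] converges
    geometrically, and [Phi_b x = x exp (S_b x)] satisfies
    [Phi_{A b} (f_b x) = lambda_b (Phi_b x)]. Since [S_b] is Lipschitz and small,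
    [Phi_b] is bi-Lipschitz near [0], and the conjugacy is its fiberwise inverse.
    For the Hoelder estimate, the fiber coordinates of two orbits over [b] and
    [b'] contract at the exact rate [q] up to a constant (bounded distortion), while
    [dist (A^k b) (A^k b')] grows at most like [m^k] for any [m > mu]; the
    resulting series is dominated by the powers of [q m^alpha], and [m] can be
    chosen with [q m^alpha < 1] as soon as [alpha < - log_mu q]. *)

Require Import Defs.
From mathcomp Require Import all_boot all_order all_algebra.
From mathcomp Require Import all_classical all_reals all_analysis.
From mathcomp Require Import complex.
From mathcomp Require Import ring lra.
Import Order.TTheory GRing.Theory Num.Theory numFieldNormedType.Exports.
Local Open Scope classical_set_scope.
Local Open Scope ring_scope.

(** * Linearization of an abstract skew product *)

(** Base distances grow while fibers shrink, and the series converges only because both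
    [f b x - f b' x] and [s b x - s b' x] carry a factor [x], which along an orbit is of order
    [q ^+ k]. For [s], where [f b x] has been divided by [x], keeping that factor costs a second
    derivative; this is where the Hoelder control of the full C^2 norm enters. The linearization is
    carried out over a bare set [B] with a self-map: the base is felt only through a number [D],
    later a power of the distance, and a rate [nu] at which discrepancies over [iter k T b] and
    [iter k T b'] may grow. Strict domination [q * nu < 1] is the only link between fiber and base.
    The constants must be uniform in [b]. A positive lower bound for the multipliers comes from
    compactness, and a bound on second derivatives from comparison with one reference fiber.
    Finally, [H] has to be fixed before [alpha] is given, so its continuity is obtained from an
    auxiliary, possibly very small, exponent. *)

Lemma geometric_series_le (R : realType) (C r : R) n :
  0 <= C -> 0 <= r < 1 -> series (geometric C r) n <= C / (1 - r).
Proof.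
move=> C0 /andP[r0 r1].
rewrite geometric_seriesE; last by rewrite lt_eqF.
rewrite ler_pM2r ?invr_gt0 ?subr_gt0// ler_piMr// gerBl.
exact: exprn_ge0.
Qed.

Lemma geometric_dominated_series (R : realType) (u : nat -> R) (C r : R) :
  0 <= r < 1 -> (forall k, `|u k| <= C * r ^+ k) ->
  cvgn (series u) /\ `|limn (series u)| <= C / (1 - r).
Proof.
move=> /andP[r0 r1] ub.
have C0 : 0 <= C by have := ub 0; rewrite expr0 mulr1; apply: le_trans.
have cv : cvgn (series u).
  apply: normed_cvg; apply: series_le_cvg ub _ => [n|n|] /=.
  - exact: normr_ge0.
  - by rewrite mulr_ge0// exprn_ge0.
  - by apply: is_cvg_geometric_series; rewrite ger0_norm.
have bd n : `|series u n| <= C / (1 - r).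
  apply: le_trans (geometric_series_le _ _ _ n C0 _); rewrite /series /= ?r0//.
  apply: le_trans (ler_norm_sum _ _ _) _.
  exact: ler_sum.
split=> //; rewrite ler_norml; apply/andP; split.
- apply: limr_ge => //; apply: nearW => n.
  by have := bd n; rewrite ler_norml => /andP[].
- apply: limr_le => //; apply: nearW => n.
  by have := bd n; rewrite ler_norml => /andP[].
Qed.

Lemma lim_series_recl (R : realType) (u : nat -> R) : cvgn (series u) ->
  limn (series u) = u 0%N + limn (series (fun k => u k.+1)).
Proof.
move=> cu.
have E n : series u n.+1 = u 0%N + series (fun k => u k.+1) n.
  by rewrite /series /= big_nat_recl.
have cS : series u n.+1 @[n --> \oo] --> limn (series u).
  by rewrite cvg_shiftS.
have cS' : series (fun k => u k.+1) n @[n --> \oo] --> limn (series u) - u 0%N.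
  have -> : series (fun k => u k.+1) = (fun n => series u n.+1 - u 0%N).
    by apply/funext => n; rewrite E addrAC subrr add0r.
  by apply: cvgB => //; exact: cvg_cst.
by rewrite (cvg_lim _ cS')// addrC subrK.
Qed.

(** The slope of [expR] at [a <= 1/4] is at most [4 / 3], because [expR (- a) >= 1 - a >= 3 / 4]. *)
Lemma expR_lipschitz_quarter (R : realType) (a b : R) : a <= 4^-1 -> b <= 4^-1 ->
  `|expR a - expR b| <= 4 / 3 * `|a - b|.
Proof.
wlog ab : a b / b <= a => [H am bm|am bm].
  case: (leP b a) => [|/ltW] ba; first exact: H.
  by rewrite distrC (distrC a); apply: H.
rewrite !ger0_norm ?subr_ge0 ?ler_expR//.
have -> : expR b = expR a * expR (b - a) by rewrite -expRD addrC subrK.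
have e4 : expR a <= 4 / 3.
  have e0 := expR_gt0 a; have := mulVf (lt0r_neq0 e0).
  by have := expR_ge1Dx (- a); rewrite expRN; nra.
by have := expR_ge1Dx (b - a); have := expR_gt0 a; nra.
Qed.

Lemma within_continuous_modulus (R : realType) (A : set R) (g : R -> R) (K : R) :
  (forall x y, A x -> A y -> `|g x - g y| <= K * `|x - y|) ->
  {within A, continuous g}.
Proof.
move=> gK; apply/subspace_continuousP => x Ax; apply/cvgrPdist_le => e e0.
have K1 : 0 < `|K| + 1 by have := normr_ge0 K; lra.
rewrite near_withinE.
have : \forall y \near x, `|x - y| <= e / (`|K| + 1).
  apply/nbhs_ballP; exists (e / (`|K| + 1)); first exact: divr_gt0.
  by move=> y; rewrite -ball_normE => /ltW.
apply: filterS => y xy Ay; apply: le_trans (gK _ _ Ax Ay) _.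
move: xy; rewrite ler_pdivlMr// => xy.
have := ler_norm K; have := normr_ge0 (x - y); nra.
Qed.

Fixpoint fiber_orbit {R : realType} {B : Type} (T : B -> B) (f : B -> R -> R)
    (b : B) (x : R) (k : nat) : R :=
  if k is k'.+1 then f (iter k' T b) (fiber_orbit T f b x k') else x.

Lemma fiber_orbitSr {R : realType} {B : Type} (T : B -> B) (f : B -> R -> R)
    (b : B) (x : R) (k : nat) :
  fiber_orbit T f b x k.+1 = fiber_orbit T f (T b) (f b x) k.
Proof. by elim: k => // k IH; rewrite [RHS]/= -IH -iterSr. Qed.

Section Linearization.
Context {R : realType} {B : Type}.
Variables (T : B -> B) (f s : B -> R -> R) (lam : B -> R).
Variables (q c L dl q1 : R).
Hypotheses (q_gt0 : 0 < q) (q1_lt1 : q1 < 1) (c_ge0 : 0 <= c) (L_ge0 : 0 <= L).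
Hypotheses (dl_gt0 : 0 < dl) (dl_le1 : dl <= 1).
Hypothesis lam_bound : forall b, 0 < lam b <= q.
Hypothesis dl_contract : q * (1 + c * dl) <= q1.
Hypothesis dl_small : L / (1 - q1) * dl <= 4^-1.
Hypothesis f0 : forall b, f b 0 = 0.
Hypothesis f_ge0 : forall b x, 0 <= x <= dl -> 0 <= f b x.
Hypothesis f_lip : forall b x y, 0 <= x <= dl -> 0 <= y <= dl ->
  `|f b x - f b y| <= q * (1 + c * Num.max x y) * `|x - y|.
Hypothesis f_exp : forall b x, 0 <= x <= dl -> f b x = lam b * x * expR (s b x).
Hypothesis s0 : forall b, s b 0 = 0.
Hypothesis s_lip : forall b x y, 0 <= x <= dl -> 0 <= y <= dl ->
  `|s b x - s b y| <= L * `|x - y|.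

Local Notation orb := (fiber_orbit T f).
Let q1_gt0 : 0 < q1.
Proof.
apply: lt_le_trans dl_contract; rewrite mulr_gt0//.
by have := mulr_ge0 c_ge0 (ltW dl_gt0); lra.
Qed.
Let L1 := L / (1 - q1).
Let L1_ge0 : 0 <= L1. Proof. by rewrite divr_ge0// subr_ge0 ltW. Qed.
Let zero_in : 0 <= (0 : R) <= dl. Proof. by rewrite lexx ltW. Qed.

Let itv_le1 x : 0 <= x <= dl -> x <= 1.
Proof. by case/andP=> _ /le_trans; apply. Qed.

Lemma fiber_contract b x y : 0 <= x <= dl -> 0 <= y <= dl ->
  `|f b x - f b y| <= q1 * `|x - y|.
Proof.
move=> hx hy; apply: le_trans (f_lip b _ _ hx hy) _; apply: ler_wpM2r => //.
apply: le_trans dl_contract; apply: ler_wpM2l; first exact: ltW.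
rewrite lerD2l; apply: ler_wpM2l => //.
by rewrite ge_max; case/andP: hx => _ ->; case/andP: hy => _ ->.
Qed.

Lemma fiber_le b x : 0 <= x <= dl -> f b x <= q1 * x.
Proof.
move=> hx; have := fiber_contract b _ _ hx zero_in; rewrite f0 !subr0.
by rewrite !ger0_norm ?f_ge0//; case/andP: hx.
Qed.

Lemma fiber_itv b x : 0 <= x <= dl -> 0 <= f b x <= dl.
Proof.
move=> hx; rewrite f_ge0//=; apply: le_trans (fiber_le b _ hx) _.
by case/andP: hx => x0 xd; apply: le_trans xd; rewrite ler_piMl// ltW.
Qed.

Lemma orbit_itv b x k : 0 <= x <= dl -> 0 <= orb b x k <= dl.
Proof. by move=> hx; elim: k => //= k IH; exact: fiber_itv. Qed.

Lemma orbit_lip b x y k : 0 <= x <= dl -> 0 <= y <= dl ->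
  `|orb b x k - orb b y k| <= q1 ^+ k * `|x - y|.
Proof.
move=> hx hy; elim: k => [|k IH] /=; first by rewrite expr0 mul1r.
apply: le_trans (fiber_contract _ _ _ (orbit_itv _ _ _ hx) (orbit_itv _ _ _ hy)) _.
by rewrite exprS -mulrA ler_pM2l.
Qed.

Lemma orbit0 b k : orb b 0 k = 0.
Proof. by elim: k => //= k ->; rewrite f0. Qed.

Lemma orbit_le b x k : 0 <= x <= dl -> orb b x k <= q1 ^+ k * x.
Proof.
move=> hx; have := orbit_lip b _ _ k hx zero_in; rewrite orbit0 !subr0.
rewrite !ger0_norm//; first by case/andP: hx.
by case/andP: (orbit_itv b _ k hx).
Qed.

Definition log_distortion b x : R :=
  limn (series (fun k => s (iter k T b) (orb b x k))).
Local Notation S := log_distortion.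

Lemma log_distortion_term_lip b x y k : 0 <= x <= dl -> 0 <= y <= dl ->
  `|s (iter k T b) (orb b x k) - s (iter k T b) (orb b y k)|
     <= L * `|x - y| * q1 ^+ k.
Proof.
move=> hx hy.
apply: le_trans (s_lip _ _ _ (orbit_itv _ _ _ hx) (orbit_itv _ _ _ hy)) _.
by rewrite -mulrA ler_wpM2l// mulrC orbit_lip.
Qed.

Lemma log_distortion_cvg b x : 0 <= x <= dl ->
  cvgn (series (fun k => s (iter k T b) (orb b x k))).
Proof.
move=> hx; apply: (geometric_dominated_series _ _ (L * `|x - 0|) q1 _ _).1.
  by rewrite q1_lt1 ltW.
move=> k; have := log_distortion_term_lip b _ _ k hx zero_in.
by rewrite orbit0 s0 !subr0.
Qed.

Lemma lim_seriesB_le (u v : nat -> R) C r : 0 <= r < 1 ->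
  cvgn (series u) -> cvgn (series v) ->
  (forall k, `|u k - v k| <= C * r ^+ k) ->
  `|limn (series u) - limn (series v)| <= C / (1 - r).
Proof.
move=> hr cu cv uv.
have [cw bw] := geometric_dominated_series _ (u - v) _ _ hr uv.
by rewrite -lim_seriesB//.
Qed.

Lemma log_distortion_lip b x y : 0 <= x <= dl -> 0 <= y <= dl ->
  `|S b x - S b y| <= L1 * `|x - y|.
Proof.
move=> hx hy; rewrite /L1 mulrAC; apply: lim_seriesB_le.
- by rewrite q1_lt1 ltW.
- exact: log_distortion_cvg.
- exact: log_distortion_cvg.
- by move=> k; exact: log_distortion_term_lip.
Qed.

Lemma log_distortion0 b : S b 0 = 0.
Proof.
rewrite /S; under eq_fun do rewrite orbit0 s0.
rewrite (_ : series _ = cst 0) ?lim_cst//.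
by apply/funext => n; rewrite /series /= big1.
Qed.

(** The orbit of [(T b, f b x)] is the tail of the orbit of [(b, x)]. This is the cohomological
    equation that [linearizer_conj] exponentiates. *)
Lemma log_distortion_step b x : 0 <= x <= dl ->
  S b x = s b x + S (T b) (f b x).
Proof.
move=> hx; rewrite /S lim_series_recl; last exact: log_distortion_cvg.
congr (_ + limn (series _)); apply/funext => k.
by rewrite fiber_orbitSr iterSr.
Qed.

Lemma log_distortion_abs b x : 0 <= x <= dl -> `|S b x| <= L1 * x.
Proof.
move=> hx; have := log_distortion_lip b _ _ hx zero_in.
by rewrite log_distortion0 !subr0 (ger0_norm (proj1 (andP hx))).
Qed.

Lemma log_distortion_small b x : 0 <= x <= dl -> `|S b x| <= 4^-1.
Proof.
move=> hx; apply: le_trans (log_distortion_abs b _ hx) (le_trans _ dl_small).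
by apply: ler_wpM2l => //; case/andP: hx.
Qed.

Lemma expR_distortion b x : 0 <= x <= dl ->
  3 / 4 <= expR (S b x) <= 4 / 3.
Proof.
move=> hx; have := log_distortion_small b _ hx; rewrite ler_norml => /andP[h1 h2].
have := expR_ge1Dx (S b x); have := expR_ge1Dx (- S b x).
rewrite expRN => h3 h4; apply/andP; split; first lra.
have e0 := expR_gt0 (S b x).
have := mulVf (lt0r_neq0 e0); nra.
Qed.

Definition linearizer b x := x * expR (S b x).
Local Notation Phi := linearizer.

Lemma linearizer0 b : Phi b 0 = 0. Proof. exact: mul0r. Qed.

Lemma linearizer_conj b x : 0 <= x <= dl -> Phi (T b) (f b x) = lam b * Phi b x.
Proof.
move=> hx; rewrite /Phi (log_distortion_step b)// expRD.
by rewrite [X in X * _ = _]f_exp// !mulrA.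
Qed.

(** The quadratic order, once transferred to the inverse, makes [h b] have derivative 0 at the zero
    section. *)
Lemma linearizer_near_id b x : 0 <= x <= dl ->
  `|Phi b x - x| <= 2 * L1 * x ^+ 2.
Proof.
move=> hx; have /andP[x0 xd] := hx.
have -> : Phi b x - x = x * (expR (S b x) - expR 0).
  by rewrite expR0 mulrBr mulr1.
rewrite normrM ger0_norm//.
have /andP[e1 e2] := expR_distortion b _ hx.
have := expR_lipschitz_quarter _ (S b x) 0; rewrite subr0 expR0.
have hS := log_distortion_small b _ hx.
move=> /(_ (le_trans (ler_norm _) hS)) h.
have {}h := h ltac:(by rewrite invr_ge0).
have := log_distortion_abs b _ hx.
by have := normr_ge0 (expR (S b x) - 1); nra.
Qed.

(** Split the increment as [(x - y) * expR (S b x)] plus [y * (expR (S b x) - expR (S b y))]. The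
    first factor lies between [3 / 4] and [4 / 3]. The second term is at most [(x - y) / 3], since
    [L1 * y <= 1/4]. Hence the slope lies between [5 / 12] and [5 / 3]. *)
Lemma linearizer_expand b x y : 0 <= x <= dl -> 0 <= y <= dl -> y <= x ->
  4^-1 * (x - y) <= Phi b x - Phi b y <= 4 * (x - y).
Proof.
move=> hx hy yx.
have /andP[ex1 ex2] := expR_distortion b _ hx.
have /andP[ey1 ey2] := expR_distortion b _ hy.
have hl := log_distortion_lip b _ _ hx hy.
have he : `|expR (S b x) - expR (S b y)| <= 4 / 3 * (L1 * (x - y)).
  apply: le_trans (expR_lipschitz_quarter _ _ _ _ _) _.
  - exact: le_trans (ler_norm _) (log_distortion_small b _ hx).
  - exact: le_trans (ler_norm _) (log_distortion_small b _ hy).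
  apply: ler_wpM2l; first lra.
  by move: hl; rewrite (ger0_norm (_ : 0 <= x - y)) ?subr_ge0.
have /andP[y0 yd] := hy.
have : y * `|expR (S b x) - expR (S b y)| <= 3^-1 * (x - y).
  apply: le_trans (_ : y * (4 / 3 * (L1 * (x - y))) <= _); first exact: ler_wpM2l.
  have : L1 * y <= 4^-1 by apply: le_trans dl_small; exact: ler_wpM2l.
  by move=> h; have : L1 * y * (x - y) <= 4^-1 * (x - y); [rewrite ler_wpM2r// subr_ge0|lra].
have -> : Phi b x - Phi b y =
   (x - y) * expR (S b x) + y * (expR (S b x) - expR (S b y)) by rewrite /Phi; ring.
rewrite -[y in y * `|_|](ger0_norm y0) -normrM ler_norml => /andP[h1 h2].
apply/andP; split; nra.
Qed.

Lemma linearizer_lower b x y : 0 <= x <= dl -> 0 <= y <= dl ->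
  `|x - y| <= 4 * `|Phi b x - Phi b y|.
Proof.
wlog yx : x y / y <= x => [H hx hy|hx hy].
  case: (leP y x) => [|/ltW] h; first exact: H.
  by rewrite distrC (distrC (Phi b x)); apply: H.
have /andP[h _] := linearizer_expand b _ _ hx hy yx.
rewrite ger0_norm ?subr_ge0// ger0_norm; first lra.
by apply: le_trans h; rewrite mulr_ge0// subr_ge0.
Qed.

Lemma linearizer_upper b x y : 0 <= x <= dl -> 0 <= y <= dl ->
  `|Phi b x - Phi b y| <= 4 * `|x - y|.
Proof.
wlog yx : x y / y <= x => [H hx hy|hx hy].
  case: (leP y x) => [|/ltW] h; first exact: H.
  by rewrite distrC (distrC x); apply: H.
have /andP[h h'] := linearizer_expand b _ _ hx hy yx.
rewrite [`|x - y|]ger0_norm ?subr_ge0// ger0_norm//.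
by apply: le_trans h; rewrite mulr_ge0// subr_ge0.
Qed.

(** The range [3 / 4 * dl] is the guaranteed height of [Phi b dl], because [expR (S b dl) >= 3 / 4];
    the intermediate value theorem does the rest. It fixes the width of the strip, uniformly in
    [b]. *)
Lemma linearizer_surj b x : 0 <= x <= 3 / 4 * dl ->
  exists y, 0 <= y <= dl /\ Phi b y = x.
Proof.
move=> /andP[x0 xd].
have dl_in : 0 <= dl <= dl by rewrite lexx ltW.
have /andP[e1 _] := expR_distortion b _ dl_in.
have Pd : x <= Phi b dl by apply: le_trans xd _; rewrite /Phi mulrC ler_pM2l.
have [||y] := @IVT _ (Phi b) 0 dl x (ltW dl_gt0).
- apply: within_continuous_modulus 4 _ => y z; rewrite /= !in_itv /=.
  exact: linearizer_upper.
- rewrite linearizer0 ge_min x0 /= le_max Pd orbT//.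
- by rewrite in_itv /= => hy <-; exists y.
Qed.

Lemma linearizer_inj b x y : 0 <= x <= dl -> 0 <= y <= dl ->
  Phi b x = Phi b y -> x = y.
Proof.
move=> hx hy e; apply/eqP; rewrite -subr_eq0 -normr_le0.
by have := linearizer_lower b _ _ hx hy; rewrite e subrr normr0 mulr0.
Qed.

(** Majorant of the product of the factors [1 + c * q1 ^+ j], [j < k], by which the contraction
    along an orbit may exceed [q ^+ k]. As the exponential of a geometric sum it is bounded in
    [k]. *)
Let growth k := expR (series (geometric c q1) k).

Let growth_ge1 k : 1 <= growth k.
Proof.
rewrite -expR0 ler_expR; apply: sumr_ge0 => j _.
by rewrite /= mulr_ge0// exprn_ge0// ltW.
Qed.

Let growth_le k : growth k <= expR (c / (1 - q1)).
Proof. by rewrite ler_expR geometric_series_le// q1_lt1 ltW. Qed.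

Let growthS k : (1 + c * q1 ^+ k) * growth k <= growth k.+1.
Proof.
rewrite /growth /series /= big_nat_recr//= expRD mulrC ler_wpM2l ?expR_ge0//.
exact: expR_ge1Dx.
Qed.

Let orbit_le_pow b x k : 0 <= x <= dl -> orb b x k <= q1 ^+ k.
Proof.
move=> hx; apply: le_trans (orbit_le b _ k hx) _.
by rewrite ler_piMr ?exprn_ge0 ?(ltW q1_gt0)// itv_le1.
Qed.

Let fiber_lip_pow b x y k : 0 <= x <= dl -> 0 <= y <= dl ->
  x <= q1 ^+ k -> y <= q1 ^+ k ->
  `|f b x - f b y| <= q * (1 + c * q1 ^+ k) * `|x - y|.
Proof.
move=> hx hy xk yk; apply: le_trans (f_lip b _ _ hx hy) _.
rewrite ler_wpM2r// ler_wpM2l ?(ltW q_gt0)// lerD2l ler_wpM2l//.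
by rewrite ge_max xk yk.
Qed.

(* Bounded distortion: orbits contract at the rate [q] itself rather than [q1],
   so that every exponent below [- log_mu q] is admissible. *)
Lemma orbit_le_sharp b x k : 0 <= x <= dl -> orb b x k <= growth k * q ^+ k * x.
Proof.
move=> hx; elim: k => [|k IH].
  by rewrite expr0 mulr1 ler_peMl//; case/andP: hx.
have hk := orbit_itv b _ k hx; have /andP[k0 _] := hk.
have := fiber_lip_pow (iter k T b) _ _ k hk zero_in (orbit_le_pow b _ k hx)
  (exprn_ge0 k (ltW q1_gt0)).
rewrite f0 !subr0 (ger0_norm k0) ger0_norm ?f_ge0// => h.
apply: le_trans h _; rewrite exprS.
have p0 : 0 <= 1 + c * q1 ^+ k by rewrite addr_ge0// mulr_ge0// exprn_ge0// ltW.
apply: le_trans (_ : q * ((1 + c * q1 ^+ k) * (growth k * q ^+ k * x)) <= _).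
  by rewrite -mulrA ler_wpM2l ?ler_wpM2l// ltW.
have : 0 <= q * q ^+ k * x.
  exact: mulr_ge0 (mulr_ge0 (ltW q_gt0) (exprn_ge0 k (ltW q_gt0))) (proj1 (andP hx)).
move=> h; rewrite -[leRHS]mulrA; apply: le_trans (ler_wpM2r h (growthS k)).
by rewrite le_eqVlt; apply/orP; left; apply/eqP; ring.
Qed.

(** Both discrepancies are evaluated on the orbit over [b'], where the factor [x] becomes at most a
    constant times [q ^+ k] and turns [nu ^+ k * D] into [(q * nu) ^+ k * D]. The gap between the
    two orbits obeys the same bound, so the series of differences is geometric. *)
Lemma log_distortion_holder nu K : 1 < nu -> q * nu < 1 -> 0 <= K ->
  exists2 K', 0 <= K' & forall b b' D, 0 <= D ->
    (forall k x, 0 <= x <= dl ->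
      `|f (iter k T b) x - f (iter k T b') x| <= K * x * (nu ^+ k * D)) ->
    (forall k x, 0 <= x <= dl ->
      `|s (iter k T b) x - s (iter k T b') x| <= K * x * (nu ^+ k * D)) ->
    forall x, 0 <= x <= dl -> `|S b x - S b' x| <= K' * D.
Proof.
move=> nu1 qnu K0.
have nu0 : 0 < nu by apply: lt_trans nu1.
(* The choice that closes the induction on the orbit gap: one step contracts the old gap by [q] up
   to distortion and adds a term with constant [K], so [K1 * q + K = K1 * (q * nu)] is wanted. This
   requires [nu > 1]. *)
pose K1 := K / (q * (nu - 1)).
have K10 : 0 <= K1 by rewrite divr_ge0// mulr_ge0 ?subr_ge0 ?ltW.
have KK : K1 * (q * (nu - 1)) = K.
  by rewrite /K1 divfK// mulf_neq0 ?lt0r_neq0// subr_gt0.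
have E0 := expR_ge0 (c / (1 - q1)).
exists ((L * K1 + K) * expR (c / (1 - q1)) / (1 - q * nu)).
  apply: divr_ge0; last by rewrite subr_ge0 ltW.
  by rewrite mulr_ge0// addr_ge0// mulr_ge0.
move=> b b' D D0 fD sD x hx.
have qn0 k : 0 <= (q * nu) ^+ k * D.
  by rewrite mulr_ge0// exprn_ge0// mulr_ge0// ltW.
have sharp k : K * orb b' x k * (nu ^+ k * D) <= K * growth k * ((q * nu) ^+ k * D).
  have h : orb b' x k <= growth k * q ^+ k.
    apply: le_trans (orbit_le_sharp b' _ k hx) _.
    by rewrite ler_piMr ?itv_le1// mulr_ge0 ?expR_ge0 ?exprn_ge0 ?ltW.
  have p0 : 0 <= nu ^+ k * D by rewrite mulr_ge0// exprn_ge0// ltW.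
  apply: le_trans (ler_wpM2r p0 (ler_wpM2l K0 h)) _.
  by rewrite exprMn le_eqVlt; apply/orP; left; apply/eqP; ring.
have orbD k : `|orb b x k - orb b' x k| <= growth k * K1 * ((q * nu) ^+ k * D).
  elim: k => [|k IH].
    rewrite subrr normr0; apply: mulr_ge0 (qn0 0%N).
    exact: mulr_ge0 (expR_ge0 _) K10.
  have hk := orbit_itv b _ k hx; have hk' := orbit_itv b' _ k hx.
  have h1 := fiber_lip_pow (iter k T b) _ _ k hk hk' (orbit_le_pow b _ k hx)
    (orbit_le_pow b' _ k hx).
  have h2 := le_trans (fD k _ hk') (sharp k).
  have /= h3 := ler_distD (f (iter k T b) (orb b' x k)) (orb b x k.+1) (orb b' x k.+1).
  apply: le_trans h3 _; apply: le_trans (lerD h1 h2) _.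
  have p0 : 0 <= c * q1 ^+ k by rewrite mulr_ge0// exprn_ge0// ltW.
  have g1 := growth_ge1 k; have g2 := growthS k.
  have g3 : growth k <= growth k.+1 by nra.
  rewrite exprS; set P := (q * nu) ^+ k * D in IH *.
  have P0 : 0 <= P by exact: qn0.
  have -> : growth k.+1 * K1 * (q * nu * (q * nu) ^+ k * D) =
     growth k.+1 * (K1 * q) * P + growth k.+1 * (K1 * (q * (nu - 1))) * P.
    by rewrite /P; ring.
  rewrite KK; apply: lerD; last by rewrite ler_wpM2r// mulrC ler_wpM2r.
  apply: le_trans (_ : q * (1 + c * q1 ^+ k) * (growth k * K1 * P) <= _).
    by rewrite ler_wpM2l// mulr_ge0 ?ltW//; lra.
  have := mulr_ge0 (mulr_ge0 K10 (ltW q_gt0)) P0.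
  move=> h; rewrite -[leRHS]mulrA; apply: le_trans (ler_wpM2r h g2).
  by rewrite le_eqVlt; apply/orP; left; apply/eqP; ring.
apply: le_trans (lim_seriesB_le _ _ ((L * K1 + K) * expR (c / (1 - q1)) * D)
  (q * nu) _ (log_distortion_cvg b _ hx) (log_distortion_cvg b' _ hx) _) _.
- by rewrite qnu andbT mulr_ge0// ltW.
- move=> k.
  have hk := orbit_itv b _ k hx; have hk' := orbit_itv b' _ k hx.
  have h1 := le_trans (s_lip (iter k T b) _ _ hk hk') (ler_wpM2l L_ge0 (orbD k)).
  have h2 := le_trans (sD k _ hk') (sharp k).
  apply: le_trans (ler_distD (s (iter k T b) (orb b' x k)) _ _) _.
  apply: le_trans (lerD h1 h2) _.
  have -> : L * (growth k * K1 * ((q * nu) ^+ k * D)) + K * growth k * ((q * nu) ^+ k * D)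
    = growth k * ((L * K1 + K) * ((q * nu) ^+ k * D)) by ring.
  have -> : (L * K1 + K) * expR (c / (1 - q1)) * D * (q * nu) ^+ k =
    expR (c / (1 - q1)) * ((L * K1 + K) * ((q * nu) ^+ k * D)) by ring.
  by rewrite ler_wpM2r ?growth_le// mulr_ge0// addr_ge0// mulr_ge0.
- by rewrite mulrAC.
Qed.

Lemma linearizer_dist b b' x : 0 <= x <= dl ->
  `|Phi b x - Phi b' x| <= 2 * `|S b x - S b' x|.
Proof.
move=> hx; have /andP[x0 xd] := hx; rewrite /linearizer -mulrBr normrM (ger0_norm x0).
have h z := le_trans (ler_norm (S z x)) (log_distortion_small z _ hx).
have := expR_lipschitz_quarter _ _ _ (h b) (h b').
have := normr_ge0 (S b x - S b' x).
have := ler_piMl (normr_ge0 (expR (S b x) - expR (S b' x))) (itv_le1 _ hx); lra.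
Qed.

Lemma linearizer_inverse : exists (K : R) (G : B -> R -> R),
  0 <= K /\ forall b x, 0 <= x <= 3 / 4 * dl ->
    [/\ 0 <= G b x <= dl, Phi b (G b x) = x, `|G b x - x| <= K * x ^+ 2 &
        f b (G b x) = G (T b) (lam b * x)].
Proof.
(* Fiberwise inverse of [Phi b], chosen by surjectivity; the default 0 is taken only when no
   preimage exists. *)
pose G b x := xget 0 [set y | 0 <= y <= dl /\ Phi b y = x].
have GP b x : 0 <= x <= 3 / 4 * dl -> 0 <= G b x <= dl /\ Phi b (G b x) = x.
  by move=> /(linearizer_surj b)[y hy]; rewrite /G; case: xgetP => [z -> //|/(_ y)].
(* [32 = 2 * 4 ^+ 2]: the quadratic estimate for [Phi] at [G b x], with [G b x <= 4 * x]. *)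
exists (32 * L1), G; split; first by rewrite mulr_ge0.
move=> b x hx; have [hG PG] := GP b x hx; have /andP[x0 xd] := hx.
split => //.
- have := linearizer_near_id b _ hG; rewrite PG distrC => /le_trans; apply.
  have : G b x <= 4 * x.
    have := linearizer_lower b _ _ hG zero_in; rewrite linearizer0 PG !subr0.
    by rewrite (ger0_norm x0) => h; apply: le_trans (ler_norm _) h.
  have /andP[G0 _] := hG => h.
  have : G b x ^+ 2 <= (4 * x) ^+ 2 by rewrite ler_pXn2r ?nnegrE ?mulr_ge0.
  by move=> /(ler_wpM2l L1_ge0); rewrite exprMn; lra.
- have /andP[l0 lq] := lam_bound b.
  have lx : 0 <= lam b * x <= 3 / 4 * dl.
    rewrite mulr_ge0 ?(ltW l0)//=; apply: le_trans xd.
    have := mulr_ge0 (ltW q_gt0) (mulr_ge0 c_ge0 (ltW dl_gt0)).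
    by have := dl_contract; have := q1_lt1 => *; apply: ler_piMl => //; lra.
  have [hG' PG'] := GP (T b) _ lx.
  (* Both sides lie in [[0, dl]] and have image [lam b * x] under [Phi (T b)], so injectivity
     identifies them. *)
  apply: (linearizer_inj (T b)) hG' _; first exact: fiber_itv.
  by rewrite linearizer_conj// PG PG'.
Qed.

End Linearization.

(** * Calculus on the unit interval *)

Section DeriveWithin.
Context {R : realType}.
Implicit Types (S : set R) (f g : R -> R) (x y l : R).

Lemma is_derive_withinP S f x l : is_derive_within S f x l <->
  forall e, 0 < e -> exists2 d, 0 < d &
    forall y, S y -> y != x -> `|y - x| < d -> `|(f y - f x) / (y - x) - l| <= e.
Proof.
split=> [/cvgrPdist_le fl e e0|fl].
  have := fl _ e0; rewrite near_withinE near_withinE => /nbhs_ballP[d d0 dP].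
  exists d => // y Sy yx yd; rewrite distrC; apply: dP => //.
  by rewrite -ball_normE /= distrC.
apply/cvgrPdist_le => e e0; have [d d0 dP] := fl _ e0.
rewrite near_withinE near_withinE; apply/nbhs_ballP; exists d => // y.
rewrite -ball_normE /= => yd yx Sy; rewrite distrC; apply: dP => //.
by rewrite distrC.
Qed.

(** Every point of the interval is an accumulation point: step right from the left half and left
    from the right half. Properness gives uniqueness of limits, hence a meaningful [derive_within],
    also at the end points. *)
Lemma within_unit_proper x : unit_itv R x -> ProperFilter (within (unit_itv R) x^').
Proof.
rewrite /unit_itv /= in_itv /= => /andP[x0 x1].
apply: Build_ProperFilter_ex => P.
rewrite /within /= => /nbhs_ballP[d /= d0 dP].
pose e := Num.min (d / 2) 4^-1.
have e0 : 0 < e by rewrite lt_min; apply/andP; split; lra.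
have ed : e < d by rewrite gt_min; apply/orP; left; lra.
have e4 : e <= 4^-1 by rewrite ge_min lexx orbT.
have [xh|xh] := leP x 2^-1.
  exists (x + e); apply: dP; rewrite /= ?in_itv /=.
  - by rewrite -ball_normE /= opprD addrA subrr sub0r normrN gtr0_norm.
  - by apply/eqP; lra.
  - by apply/andP; split; lra.
exists (x - e); apply: dP; rewrite /= ?in_itv /=.
- by rewrite -ball_normE /= opprB addrC subrK gtr0_norm.
- by apply/eqP; lra.
- by apply/andP; split; lra.
Qed.

Lemma derive_withinE f x l : unit_itv R x -> is_derive_within (unit_itv R) f x l ->
  derive_within (unit_itv R) f x = l.
Proof.
move=> /within_unit_proper pF fl.
exact: (@cvg_lim _ (@Rhausdorff R) _ _ pF).
Qed.

Lemma derivable_withinP f x : unit_itv R x -> derivable_within (unit_itv R) f x ->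
  is_derive_within (unit_itv R) f x (derive_within (unit_itv R) f x).
Proof. by move=> Ix [l fl]; rewrite (derive_withinE f x l). Qed.

Lemma is_derive_withinB S f g x lf lg :
  is_derive_within S f x lf -> is_derive_within S g x lg ->
  is_derive_within S (fun y => f y - g y) x (lf - lg).
Proof.
move=> fl gl; rewrite /is_derive_within.
have -> : (fun y => (f y - g y - (f x - g x)) / (y - x)) =
    (fun y => (f y - f x) / (y - x)) \- (fun y => (g y - g x) / (y - x)).
  by apply/funext => y /=; rewrite -mulrBl; congr (_ / _); ring.
exact: cvgB fl gl.
Qed.

Lemma is_derive_within_eq S f g x l : S x -> (forall y, S y -> f y = g y) ->
  is_derive_within S f x l -> is_derive_within S g x l.
Proof.
move=> Sx fg /is_derive_withinP fl; apply/is_derive_withinP => e /fl[d d0 dP].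
by exists d => // y Sy yx yd; rewrite -!fg//; exact: dP.
Qed.

Lemma derive_within_continuous f (df : R -> R) :
  (forall x, unit_itv R x -> is_derive_within (unit_itv R) f x (df x)) ->
  {within unit_itv R, continuous f}.
Proof.
move=> fd; apply/subspace_continuousP => x Ix; apply/cvgrPdist_le => e e0.
have /is_derive_withinP/(_ _ ltr01)[d d0 dP] := fd _ Ix.
have K0 : 0 < `|df x| + 1 by rewrite ltr_wpDl.
rewrite near_withinE; apply/nbhs_ballP.
exists (Num.min d (e / (`|df x| + 1))) => [|y].
  by rewrite /= lt_min d0 divr_gt0.
rewrite -ball_normE /= lt_min => /andP[yd ye] Iy.
have [->|yx] := eqVneq y x; first by rewrite subrr normr0 ltW.
rewrite distrC in yd; have h := dP y Iy yx yd.
have yx0 : y - x != 0 by rewrite subr_eq0.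
suff : `|f y - f x| <= e by rewrite distrC.
rewrite -[f y - f x](divfK yx0) normrM; move: h; set u := _ / _ => h.
have : `|u| <= `|df x| + 1.
  have := ler_normD (u - df x) (df x); rewrite subrK; lra.
move=> hu; move: ye; rewrite ltr_pdivlMr// distrC => ye.
have := normr_ge0 (y - x); nra.
Qed.

Lemma is_derive_interior f x l : 0 < x < 1 ->
  is_derive_within (unit_itv R) f x l -> is_derive x 1 f l.
Proof.
move=> /andP[x0 x1] /is_derive_withinP fl.
have cv : h^-1 *: ((f \o shift x) (h *: 1) - f x) @[h --> 0^'] --> l.
  apply/cvgrPdist_le => e /fl[d d0 dP]; rewrite near_withinE.
  apply/nbhs_ballP; exists (Num.min d (Num.min x (1 - x))).
    by rewrite /= !lt_min d0 x0 subr_gt0.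
  move=> h; rewrite -ball_normE /= sub0r normrN !lt_min => /and3P[hd hx hx1] h0.
  have -> : h *: (1 : R) = h by rewrite /GRing.scale /= mulr1.
  have := dP (h + x); rewrite addrK distrC [h^-1 *: _]mulrC; apply => //.
  - rewrite /unit_itv /= in_itv /=; move: hx hx1; rewrite !ltr_norml.
    by move=> /andP[? ?] /andP[? ?]; apply/andP; split; lra.
  - by rewrite -subr_eq0 addrK.
by apply: DeriveDef; [apply/cvg_ex; exists l|exact: cvg_lim].
Qed.

Lemma MVT_within f df x y :
  (forall x, unit_itv R x -> is_derive_within (unit_itv R) f x (df x)) ->
  0 <= x -> x < y -> y <= 1 ->
  exists2 c, x < c < y & f y - f x = df c * (y - x).
Proof.
move=> fd x0 xy y1.
have [z||c] := @MVT _ f df x y xy.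
- rewrite in_itv /= => /andP[xz zy]; apply: is_derive_interior.
    by rewrite (le_lt_trans x0 xz) (lt_le_trans zy y1).
  by apply: fd; rewrite /unit_itv /= in_itv /=; apply/andP; split; lra.
- apply: continuous_subspaceW (derive_within_continuous _ _ fd).
  by apply: subset_itv; rewrite ?bnd_simp.
- by rewrite in_itv /= => ? ->; exists c.
Qed.

Lemma derive_within_lipschitz f df M :
  (forall x, unit_itv R x -> is_derive_within (unit_itv R) f x (df x)) ->
  (forall x, unit_itv R x -> `|df x| <= M) ->
  forall x y, unit_itv R x -> unit_itv R y -> `|f x - f y| <= M * `|x - y|.
Proof.
move=> fd dM x y.
wlog xy : x y / y < x => [H Ix Iy|].
  case: (ltgtP y x) => [|h|->]; first by move/H; apply.
  - by rewrite distrC (distrC x); apply: H.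
  - by rewrite !subrr normr0 mulr0.
rewrite /unit_itv /= !in_itv /= => /andP[x0 x1] /andP[y0 y1].
have [c /andP[yc cx] ->] := MVT_within f df _ _ fd y0 xy x1.
rewrite normrM ler_wpM2r// dM// /unit_itv /= in_itv /=.
by apply/andP; split; lra.
Qed.

Lemma continuous_unit_bounded f : {within unit_itv R, continuous f} ->
  exists M, forall x, unit_itv R x -> `|f x| <= M.
Proof.
move=> fc; have [c1 _ h1] := EVT_max ler01 fc; have [c2 _ h2] := EVT_min ler01 fc.
exists (`|f c1| + `|f c2|) => x Ix.
have := h1 x Ix; have := h2 x Ix; rewrite ler_norml.
have := ler_norm (f c1); have := ler_norm (- f c2); rewrite normrN.
have := normr_ge0 (f c1); have := normr_ge0 (f c2).
by move=> *; apply/andP; split; lra.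
Qed.

(** The mean value theorem gives [f x / x = df c] with [c < x], hence the first bound. For [y < x]
    the difference of quotients equals [(df c - df c') * ((x - y) / x)] with [c] and [c'] both
    between 0 and [x]; then [M * x] cancels the denominator, so the Lipschitz constant does not blow
    up at 0. *)
Lemma taylor_fixed_point f df M : f 0 = 0 ->
  (forall x, unit_itv R x -> is_derive_within (unit_itv R) f x (df x)) ->
  (forall x y, unit_itv R x -> unit_itv R y -> `|df x - df y| <= M * `|x - y|) ->
  (forall x, 0 < x <= 1 -> `|f x / x - df 0| <= M * x) /\
  (forall x y, 0 < x <= 1 -> 0 < y <= 1 -> `|f x / x - f y / y| <= M * `|x - y|).
Proof.
move=> f0 fd dfL.
have I01 x : 0 <= x -> x <= 1 -> unit_itv R x.
  by move=> *; rewrite /unit_itv /= in_itv /=; apply/andP.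
have M0 : 0 <= M.
  have := dfL 1 0 (I01 _ ler01 (lexx _)) (I01 _ (lexx _) ler01).
  by rewrite subr0 normr1 mulr1; apply: le_trans.
have mv x : 0 < x <= 1 -> exists2 c, 0 < c < x & f x = df c * x.
  move=> /andP[x0 x1]; have [c hc] := MVT_within f df _ _ fd (lexx 0) x0 x1.
  by rewrite f0 !subr0 => e; exists c.
split=> [x hx|x y].
  have [c /andP[c0 cx] ->] := mv _ hx; have /andP[x0 x1] := hx.
  rewrite mulfK ?gt_eqF//; apply: (le_trans (dfL c 0 _ _));
    [by apply: I01; lra|by apply: I01; lra|].
  by rewrite subr0 gtr0_norm// ler_wpM2l// ltW.
wlog yx : x y / y < x => [H hx hy|hx hy].
  case: (ltgtP y x) => [|h|->]; first by move/H; apply.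
  - by rewrite distrC (distrC x); apply: H.
  - by rewrite !subrr normr0 mulr0.
have [c' /andP[c'0 c'y] fy] := mv _ hy.
have /andP[x0 x1] := hx; have /andP[y0 y1] := hy.
have [c /andP[yc cx] fxy] := MVT_within f df _ _ fd (ltW y0) yx x1.
have -> : f x / x - f y / y = (df c - df c') * ((x - y) / x).
  have -> : f x = df c * (x - y) + f y by rewrite -fxy subrK.
  by rewrite fy; field; rewrite !gt_eqF.
rewrite normrM (gtr0_norm (_ : 0 < (x - y) / x)) ?divr_gt0 ?subr_gt0//.
rewrite (gtr0_norm (_ : 0 < x - y)) ?subr_gt0//.
apply: le_trans (_ : (M * x) * ((x - y) / x) <= _).
  rewrite ler_wpM2r//; first by rewrite divr_ge0// ?subr_ge0 ltW.
  apply: (le_trans (dfL c c' _ _)); [by apply: I01; lra|by apply: I01; lra|].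
  by rewrite ler_wpM2l// ler_norml; apply/andP; split; lra.
by rewrite le_eqVlt; apply/orP; left; apply/eqP; field; rewrite gt_eqF.
Qed.

Lemma sup_norm_le f S (M : R) x : (sup_norm S f <= M%:E)%E -> S x -> `|f x| <= M.
Proof.
move=> /ereal_supP h Sx; rewrite -lee_fin; apply: h; by exists x.
Qed.

Lemma sup_norm_ge0 f S x : S x -> (0 <= sup_norm S f)%E.
Proof.
move=> Sx; apply: le_trans (_ : (`|f x|%:E <= _)%E); first by rewrite lee_fin.
by apply: ereal_sup_ubound; exists x.
Qed.

Lemma C2_norm_le f (M : R) x : (C2_norm (unit_itv R) f <= M%:E)%E -> unit_itv R x ->
  [/\ `|f x| <= M, `|derive_within (unit_itv R) f x| <= M &
      `|derive_within (unit_itv R) (derive_within (unit_itv R) f) x| <= M].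
Proof.
rewrite /C2_norm => h Ix; have p g := sup_norm_ge0 g _ _ Ix.
split; apply: sup_norm_le Ix; apply: le_trans h.
- by rewrite -addeA leeDl// adde_ge0.
- by rewrite addeAC leeDr// adde_ge0.
- by rewrite leeDr// adde_ge0.
Qed.

End DeriveWithin.

Lemma unit_itvE (R : realType) (x : R) : unit_itv R x = (0 <= x <= 1) :> Prop.
Proof. by rewrite /unit_itv /= in_itv. Qed.

Lemma ln_lipschitz_half (R : realType) (a b : R) : 2^-1 <= a -> 2^-1 <= b ->
  `|ln a - ln b| <= 2 * `|a - b|.
Proof.
wlog ab : a b / b <= a => [H ha hb|ha hb].
  case: (leP b a) => [|/ltW] h; first exact: H.
  by rewrite distrC (distrC a); apply: H.
have a0 : 0 < a by lra.
have b0 : 0 < b by lra.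
rewrite !ger0_norm ?subr_ge0 ?ler_ln//.
rewrite -ln_div ?posrE//; have -> : a / b = 1 + (a - b) / b by field; rewrite gt_eqF.
have h0 : 0 <= (a - b) / b by rewrite divr_ge0 ?subr_ge0// ltW.
apply: le_trans (le_ln1Dx _) _; first lra.
rewrite ler_pdivrMr//; nra.
Qed.

(** If the multiplier were nonpositive, Taylor would give [f y <= M * y ^+ 2], while a Lipschitz
    inverse with constant [C] forces [y <= C * f y]. These clash once [C * M * y < 1], as at
    [y = (C * M + 1)^-1]. *)
Lemma diffeo_multiplier_gt0 (R : realType) (f : R -> R) :
  orientation_preserving_diffeo f -> class_C 2 (unit_itv R) f -> f 0 = 0 ->
  0 < derive_within (unit_itv R) f 0.
Proof.
move=> [fI _ _ [g [gI [gd gc] fg gf]]] [fd [fd1 fc]] f0.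
set l := derive_within _ _ _.
have I0 : unit_itv R 0 by rewrite unit_itvE lexx ler01.
have [M hM] := continuous_unit_bounded _ fc.
have [C hC] := continuous_unit_bounded _ gc.
have M0 := le_trans (normr_ge0 _) (hM _ I0); have C0 := le_trans (normr_ge0 _) (hC _ I0).
have dL := derive_within_lipschitz _ _ _ (fun x Ix => derivable_withinP _ _ Ix (fd1 _ Ix)) hM.
have [hT _] := taylor_fixed_point _ _ _ f0 (fun x Ix => derivable_withinP _ _ Ix (fd _ Ix)) dL.
have gL := derive_within_lipschitz _ _ _ (fun x Ix => derivable_withinP _ _ Ix (gd _ Ix)) hC.
rewrite ltNge; apply/negP => l0.
have CM := mulr_ge0 C0 M0.
pose y := (C * M + 1)^-1.
have y0 : 0 < y by rewrite invr_gt0; lra.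
have ye : y * (C * M + 1) = 1 by rewrite mulVf// gt_eqF//; lra.
have y1 : y <= 1 by nra.
have Iy : unit_itv R y by rewrite unit_itvE (ltW y0).
have := gL (f y) (f 0) (fI _ Iy) (fI _ I0).
rewrite !fg ?inE// f0 !subr0 (gtr0_norm y0).
have : 0 <= f y by move: (fI _ Iy); rewrite unit_itvE => /andP[].
move=> fy; rewrite (ger0_norm fy).
have := hT y; rewrite y0 y1 => /(_ isT); rewrite ler_norml => /andP[_ h].
have {}h : f y <= M * y * y.
  by rewrite -ler_pdivrMr//; move: h; rewrite -/l; lra.
move=> h2; have : y <= C * (M * y * y) by apply: le_trans h2 _; exact: ler_wpM2l.
have -> : C * (M * y * y) = y * (C * M * y) by ring.
by nra.
Qed.

(** * Uniform estimates for a family of C^2 fiber maps and their logarithmic slopes *)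

Section FiberMaps.
Context {R : realType} {B : Type}.
Variables (T : B -> B) (f : B -> R -> R) (W : B -> B -> R) (b0 : B) (K0 : R).
Hypothesis fC2 : forall b, class_C 2 (unit_itv R) (f b).
Hypothesis f0 : forall b, f b 0 = 0.
Hypothesis fI : forall b x, unit_itv R x -> 0 <= f b x.
Hypothesis fW : forall b b',
  (C2_norm (unit_itv R) (fun x => (f b x - f b' x)%R) <= (W b b')%:E)%E.
Hypothesis W_bounded : forall b b', W b b' <= K0.

Local Notation f1 b := (derive_within (unit_itv R) (f b)).
Local Notation f2 b := (derive_within (unit_itv R) (derive_within (unit_itv R) (f b))).
Local Notation lam b := (derive_within (unit_itv R) (f b) 0).

Let fd b x : unit_itv R x -> is_derive_within (unit_itv R) (f b) x (f1 b x).
Proof. by move=> Ix; apply: derivable_withinP => //; apply: (fC2 b).1. Qed.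

Let fd1 b x : unit_itv R x -> is_derive_within (unit_itv R) (f1 b) x (f2 b x).
Proof. by move=> Ix; apply: derivable_withinP => //; apply: (fC2 b).2.1. Qed.

Let dfE b b' x : unit_itv R x ->
  derive_within (unit_itv R) (fun x => f b x - f b' x) x = f1 b x - f1 b' x.
Proof.
by move=> Ix; apply: derive_withinE => //; apply: is_derive_withinB; exact: fd.
Qed.

Let ddfE b b' x : unit_itv R x ->
  derive_within (unit_itv R) (derive_within (unit_itv R) (fun x => f b x - f b' x)) x
    = f2 b x - f2 b' x.
Proof.
move=> Ix; apply: derive_withinE => //.
apply: is_derive_within_eq (is_derive_withinB _ _ _ _ _ _ (fd1 b _ Ix) (fd1 b' _ Ix)) => //.
by move=> y Iy; rewrite dfE.
Qed.

Let unit0 : unit_itv R 0. Proof. by rewrite unit_itvE lexx ler01. Qed.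

Lemma fiber_derive_dist b b' x : unit_itv R x -> `|f1 b x - f1 b' x| <= W b b'.
Proof. by move=> Ix; have [_ + _] := C2_norm_le _ _ _ (fW b b') Ix; rewrite dfE. Qed.

Lemma fiber_derive2_dist b b' x : unit_itv R x -> `|f2 b x - f2 b' x| <= W b b'.
Proof. by move=> Ix; have [_ _] := C2_norm_le _ _ _ (fW b b') Ix; rewrite ddfE. Qed.

Lemma fiber_dist_ge0 b b' : 0 <= W b b'.
Proof. exact: le_trans (normr_ge0 _) (fiber_derive_dist b b' _ unit0). Qed.

(** All fiber maps fix 0, so integrating the bound on the first derivatives from 0 gains the factor
    [x]. *)
Lemma fiber_dist b b' x : unit_itv R x -> `|f b x - f b' x| <= W b b' * x.
Proof.
move=> Ix; have := derive_within_lipschitz (fun x => f b x - f b' x)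
  (fun x => f1 b x - f1 b' x) (W b b')
  (fun x Ix => is_derive_withinB _ _ _ _ _ _ (fd b _ Ix) (fd b' _ Ix))
  (fun x Ix => fiber_derive_dist b b' x Ix) x 0 Ix unit0.
rewrite !f0 !subr0 (ger0_norm (_ : 0 <= x))//.
by move: Ix; rewrite unit_itvE => /andP[].
Qed.

(** Taylor applied to the difference [f b - f b'], whose second derivative is bounded by [W b b'];
    the factor [x] survives the division. *)
Lemma fiber_quotient_dist b b' x : 0 < x <= 1 ->
  `|(f b x / x - lam b) - (f b' x / x - lam b')| <= W b b' * x.
Proof.
move=> hx.
have dL := derive_within_lipschitz (fun x => f1 b x - f1 b' x)
  (fun x => f2 b x - f2 b' x) (W b b')
  (fun x Ix => is_derive_withinB _ _ _ _ _ _ (fd1 b _ Ix) (fd1 b' _ Ix))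
  (fun x Ix => fiber_derive2_dist b b' x Ix).
have [|+ _] := taylor_fixed_point (fun x => f b x - f b' x) _ _ _
  (fun x Ix => is_derive_withinB _ _ _ _ _ _ (fd b _ Ix) (fd b' _ Ix)) dL.
  by rewrite !f0 subr0.
move=> /(_ _ hx); rewrite mulrBl.
by congr (`|_| <= _); ring.
Qed.

(** One fiber [b0] is bounded by continuity on a compact interval, and every other one differs from
    it by at most [K0]. *)
Lemma fiber_derive2_bounded : exists2 M, 0 <= M &
  forall b x, unit_itv R x -> `|f2 b x| <= M.
Proof.
have [M hM] := continuous_unit_bounded _ (fC2 b0).2.2.
have h b x : unit_itv R x -> `|f2 b x| <= M + K0.
  move=> Ix; have := ler_normD (f2 b x - f2 b0 x) (f2 b0 x); rewrite subrK.
  have := fiber_derive2_dist b b0 _ Ix; have := W_bounded b b0; have := hM _ Ix; lra.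
by exists (M + K0) => //; apply: le_trans (normr_ge0 _) (h b0 _ unit0).
Qed.

Lemma fiber_derive_lipschitz M : (forall b x, unit_itv R x -> `|f2 b x| <= M) ->
  forall b x y, unit_itv R x -> unit_itv R y -> `|f1 b x - f1 b y| <= M * `|x - y|.
Proof. by move=> hM b; exact: derive_within_lipschitz (fd1 b) (hM b). Qed.

Variables (q l : R).
Hypotheses (l_gt0 : 0 < l) (q_lt1 : q < 1).
Hypothesis lam_bound : forall b, l <= lam b <= q.

(** At [x = 0] the conventions [0^-1 = 0] and [ln 0 = 0] give the value 0, which is also the
    continuous extension, the quotient tending to 1. *)
Definition log_slope b x := ln (f b x / (lam b * x)).
Local Notation s := log_slope.

Let lam_gt0 b : 0 < lam b.
Proof. by apply: lt_le_trans l_gt0 _; case/andP: (lam_bound b). Qed.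

Let slopeE b x : f b x / (lam b * x) = (f b x / x) / lam b.
Proof. by rewrite invfM mulrAC mulrA. Qed.

Section SmallFiber.
Variables (M dl : R).
Hypotheses (M_ge0 : 0 <= M) (dl_gt0 : 0 < dl) (dl_le1 : dl <= 1).
Hypothesis hM : forall b x, unit_itv R x -> `|f2 b x| <= M.
Hypothesis dl_M : M * dl <= l / 2.

Let in01 x : 0 <= x <= dl -> unit_itv R x.
Proof. by rewrite unit_itvE => /andP[-> /le_trans ->]. Qed.

Let pos01 x : 0 < x -> x <= dl -> 0 < x <= 1.
Proof. by move=> -> /le_trans ->. Qed.

Let taylor b := taylor_fixed_point _ _ _ (f0 b) (fd b) (fiber_derive_lipschitz _ hM b).

Lemma slope_ge_half b x : 0 < x -> x <= dl -> 2^-1 <= f b x / (lam b * x).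
Proof.
move=> x0 xd; rewrite slopeE ler_pdivlMr//.
have := (taylor b).1 _ (pos01 _ x0 xd); rewrite ler_norml => /andP[h _].
have /andP[ll _] := lam_bound b.
have : M * x <= M * dl by rewrite ler_wpM2l.
by have := dl_M; lra.
Qed.

Lemma log_slope0 b : s b 0 = 0.
Proof. by rewrite /s mulr0 invr0 mulr0 ln0. Qed.

Lemma fiber_exp_slope b x : 0 <= x <= dl -> f b x = lam b * x * expR (s b x).
Proof.
move=> /andP[]; rewrite le_eqVlt => /predU1P[<- _|x0 xd].
  by rewrite f0 mulr0 mul0r.
rewrite lnK ?posrE; last by apply: lt_le_trans (slope_ge_half b _ x0 xd); rewrite invr_gt0.
by rewrite mulrC divfK// mulf_neq0// gt_eqF.
Qed.

Let slope_near1 b x : 0 < x -> x <= dl -> `|f b x / (lam b * x) - 1| <= M / l * x.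
Proof.
move=> x0 xd; rewrite slopeE.
have -> : f b x / x / lam b - 1 = (f b x / x - lam b) / lam b.
  by rewrite mulrBl divff ?gt_eqF.
rewrite normrM normfV (gtr0_norm (lam_gt0 b)) mulrAC.
apply: ler_pM => //; first by rewrite invr_ge0 ltW.
  exact: (taylor b).1 _ (pos01 _ x0 xd).
by rewrite lef_pV2 ?posrE//; case/andP: (lam_bound b).
Qed.

Lemma log_slope_lip b x y : 0 <= x <= dl -> 0 <= y <= dl ->
  `|s b x - s b y| <= 2 * (M / l) * `|x - y|.
Proof.
have half1 : 2^-1 <= (1 : R) by lra.
wlog yx : x y / y <= x => [H hx hy|].
  case: (leP y x) => [|/ltW] h; first exact: H.
  by rewrite distrC (distrC x); apply: H.
move=> /andP[+ xd] /andP[+ yd]; rewrite le_eqVlt => /predU1P[x0|x0].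
  rewrite -x0 in yx * => y0; have -> : y = 0 by apply/eqP; rewrite eq_le yx.
  by rewrite !subrr normr0 mulr0.
rewrite le_eqVlt => /predU1P[<-|y0].
  rewrite log_slope0 !subr0 (gtr0_norm x0) -mulrA.
  have := ln_lipschitz_half _ _ 1 (slope_ge_half b _ x0 xd) half1.
  by rewrite ln1 subr0 => /le_trans; apply; rewrite ler_wpM2l// slope_near1.
apply: le_trans (ln_lipschitz_half _ _ _ (slope_ge_half b _ x0 xd) (slope_ge_half b _ y0 yd)) _.
rewrite !slopeE -mulrBl normrM normfV (gtr0_norm (lam_gt0 b)) -mulrA ler_wpM2l//.
rewrite mulrAC; apply: ler_pM => //.
- by rewrite invr_ge0 ltW.
- exact: (taylor b).2 _ _ (pos01 _ x0 xd) (pos01 _ y0 yd).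
- by rewrite lef_pV2 ?posrE//; case/andP: (lam_bound b).
Qed.

Lemma log_slope_dist b b' x : 0 <= x <= dl ->
  `|s b x - s b' x| <= 2 * (l^-1 + M / l ^+ 2) * x * W b b'.
Proof.
move=> /andP[]; rewrite le_eqVlt => /predU1P[<- _|x0 xd].
  by rewrite !log_slope0 subrr normr0 mulr0 mul0r.
apply: le_trans (ln_lipschitz_half _ _ _ (slope_ge_half b _ x0 xd) (slope_ge_half b' _ x0 xd)) _.
rewrite -!mulrA ler_wpM2l// !slopeE.
set u := f b x / x; set u' := f b' x / x.
(* Subtracting the multipliers before splitting makes each summand of order [x]; the naive splitting
   would leave [u' * (lam b' - lam b)], which does not vanish at 0. *)
have -> : u / lam b - u' / lam b' =
  ((u - lam b) - (u' - lam b')) / lam b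
  + (u' - lam b') * ((lam b' - lam b) / (lam b * lam b')).
  by field; rewrite !gt_eqF.
have inv_le a : l <= a -> a^-1 <= l^-1.
  by move=> la; rewrite lef_pV2 ?posrE// (lt_le_trans l_gt0).
have /andP[lb _] := lam_bound b; have /andP[lb' _] := lam_bound b'.
apply: le_trans (ler_normD _ _) _; rewrite [leRHS]mulrDl; apply: lerD.
  rewrite normrM normfV (gtr0_norm (lam_gt0 b)) mulrC.
  apply: ler_pM; rewrite ?invr_ge0 ?(ltW (lam_gt0 b))//; first exact: inv_le.
  by rewrite mulrC; apply: fiber_quotient_dist; exact: pos01.
rewrite normrM.
apply: le_trans (_ : (M * x) * (W b b' * (l^-1 * l^-1)) <= _).
  apply: ler_pM => //; first exact: (taylor b').1 _ (pos01 _ x0 xd).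
  rewrite normrM normfV (gtr0_norm (_ : 0 < lam b * lam b')) ?mulr_gt0//.
  apply: ler_pM => //; first by rewrite invr_ge0 mulr_ge0 ?ltW.
    by rewrite distrC; exact: fiber_derive_dist.
  by rewrite invfM; apply: ler_pM; rewrite ?invr_ge0 ?(ltW (lam_gt0 _))// inv_le.
by rewrite le_eqVlt; apply/orP; left; apply/eqP; field; rewrite gt_eqF.
Qed.

(** The derivative at [c] is at most [q + M * c]. Keeping the dependence on the point, instead of a
    uniform constant, is what lets the rate [q] be recovered along orbits. *)
Lemma fiber_lip_max b x y : 0 <= x <= dl -> 0 <= y <= dl ->
  `|f b x - f b y| <= q * (1 + M / q * Num.max x y) * `|x - y|.
Proof.
have q0 : 0 < q by apply: lt_le_trans (lam_gt0 b) _; case/andP: (lam_bound b).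
wlog yx : x y / y < x => [H|hx hy].
  case/boolP: (y < x) => [|yx]; first exact: H.
  case/boolP: (x < y) => [xy hx hy|xy _ _].
    by rewrite distrC (distrC x) maxC; apply: H.
  have -> : y = x by apply/eqP; rewrite eq_le !leNgt xy yx.
  by rewrite !subrr normr0 mulr0.
have /andP[x0 xd] := hx; have /andP[y0 yd] := hy.
have [c /andP[yc cx] ->] := MVT_within (f b) _ _ _ (fd b) y0 yx (le_trans xd dl_le1).
rewrite normrM ler_wpM2r// (max_idPl (ltW yx)).
have -> : q * (1 + M / q * x) = q + M * x by field; rewrite gt_eqF.
have hc : unit_itv R c by apply: in01; apply/andP; split; lra.
have := fiber_derive_lipschitz _ hM b _ _ hc unit0.
have := ler_normD (f1 b c - lam b) (lam b); rewrite subrK subr0.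
rewrite (gtr0_norm (lam_gt0 b)) (gtr0_norm (_ : 0 < c)); last lra.
have : M * c <= M * x by rewrite ler_wpM2l// ltW.
have /andP[_ lq] := lam_bound b; lra.
Qed.

End SmallFiber.

(** [Phi] and [G] are chosen before [nu], so one conjugacy serves all Hoelder exponents. Dependence
    on the base is recorded for [Phi] only; for [G] it follows from the lower bi-Lipschitz bound. *)
Lemma nonstationary_linearization :
  exists (dl eps K : R) (Phi G : B -> R -> R),
  [/\ [/\ 0 < dl <= 1, 0 < eps <= dl & 0 <= K],
   forall b x y, 0 <= x <= dl -> 0 <= y <= dl ->
     `|Phi b x - Phi b y| <= 4 * `|x - y| /\ `|x - y| <= 4 * `|Phi b x - Phi b y|,
   forall b x, 0 <= x <= eps ->
     [/\ 0 <= G b x <= dl, Phi b (G b x) = x, `|G b x - x| <= K * x ^+ 2 &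
         f b (G b x) = G (T b) (lam b * x)] &
   forall nu K, 1 < nu -> q * nu < 1 -> 0 <= K ->
     exists2 K', 0 <= K' & forall b b' D, 0 <= D ->
       (forall k, W (iter k T b) (iter k T b') <= K * (nu ^+ k * D)) ->
       forall x, 0 <= x <= dl -> `|Phi b x - Phi b' x| <= K' * D].
Proof.
have [M M0 hM] := fiber_derive2_bounded.
have q1' := q_lt1; have l0 := l_gt0.
have /andP[lq1 lq2] := lam_bound b0; have q0 : 0 < q by lra.
pose q1 := (1 + q) / 2; have q11 : q1 < 1 by rewrite /q1; lra.
have qq1 : 0 < q1 - q by rewrite /q1; lra.
pose L := 2 * (M / l).
have L0 : 0 <= L by rewrite mulr_ge0// divr_ge0// ltW.
pose c := M / q; have c0 : 0 <= c by rewrite divr_ge0// ltW.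
(* In order: [dl <= 1], slopes at least one half, contraction at the intermediate rate [q1], and
   distortion at most [1/4]. The [+ 1] keeps the denominators positive. *)
pose dl := Num.min 1 (Num.min (l / 2 / (M + 1)) (Num.min ((q1 - q) / (M + 1))
  ((1 - q1) / 4 / (L + 1)))).
have M1 : 0 < M + 1 by lra.
have L1 : 0 < L + 1 by lra.
have dl0 : 0 < dl.
  by rewrite !lt_min ltr01 !divr_gt0// subr_gt0.
have dl1 : dl <= 1 by rewrite ge_min lexx.
have dlM : M * dl <= l / 2.
  have : dl <= l / 2 / (M + 1) by rewrite !ge_min lexx orbT.
  rewrite ler_pdivlMr//; nra.
have dlq : q * (1 + c * dl) <= q1.
  have : dl <= (q1 - q) / (M + 1) by rewrite !ge_min lexx !orbT.
  rewrite ler_pdivlMr// => h.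
  have -> : q * (1 + c * dl) = q + M * dl by rewrite /c; field; rewrite gt_eqF.
  nra.
have dlL : L / (1 - q1) * dl <= 4^-1.
  have : dl <= (1 - q1) / 4 / (L + 1) by rewrite !ge_min lexx !orbT.
  rewrite ler_pdivlMr// => h; rewrite mulrAC ler_pdivrMr; last by lra.
  nra.
have lamq b : 0 < lam b <= q by rewrite lam_gt0; case/andP: (lam_bound b).
have f_ge0 b x : 0 <= x <= dl -> 0 <= f b x.
  by move=> /andP[x0 xd]; apply: fI; rewrite unit_itvE x0 (le_trans xd).
have f_lip b x y : 0 <= x <= dl -> 0 <= y <= dl ->
  `|f b x - f b y| <= q * (1 + c * Num.max x y) * `|x - y|.
  exact: (fiber_lip_max M dl).
have f_exp b x : 0 <= x <= dl -> f b x = lam b * x * expR (s b x).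
  exact: (fiber_exp_slope M dl).
have s_lip b x y : 0 <= x <= dl -> 0 <= y <= dl -> `|s b x - s b y| <= L * `|x - y|.
  exact: (log_slope_lip M dl).
have s_dist b b' x : 0 <= x <= dl ->
  `|s b x - s b' x| <= 2 * (l^-1 + M / l ^+ 2) * x * W b b'.
  exact: (log_slope_dist M dl).
have [K [G [K_ge0 GP]]] := linearizer_inverse T f s (fun b => lam b) q c L dl q1
  q0 q11 c0 L0 dl0 lamq dlq dlL f0 f_ge0 f_lip f_exp log_slope0 s_lip.
exists dl, (3 / 4 * dl), K, (linearizer T f s), G; split => //.
- by split => //; apply/andP; split => //; lra.
- move=> b x y hx hy; split.
    exact: (linearizer_upper T f s q c L dl q1) q0 q11 c0 L0 dl0 dlq dlL
      f0 f_ge0 f_lip log_slope0 s_lip _ _ _ hx hy.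
  exact: (linearizer_lower T f s q c L dl q1) q0 q11 c0 L0 dl0 dlq dlL
      f0 f_ge0 f_lip log_slope0 s_lip _ _ _ hx hy.
- move=> nu K1 nu1 qnu K10.
  pose C := 2 * (l^-1 + M / l ^+ 2).
  have C0 : 0 <= C.
    rewrite /C mulr_ge0// addr_ge0 ?divr_ge0 ?exprn_ge0 ?invr_ge0//; exact: ltW.
  (* One constant for both discrepancies: that of [f] has factor 1, that of [s] has factor [C]. *)
  have CK : 0 <= (1 + C) * K1 by rewrite mulr_ge0// addr_ge0.
  have [K' K'0 hK'] := log_distortion_holder T f s q c L dl q1 q0 q11 c0 L0 dl0
    dl1 dlq f0 f_ge0 f_lip log_slope0 s_lip _ _ nu1 qnu CK.
  exists (2 * K'); first by rewrite mulr_ge0.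
  move=> b b' D D0 hW x hx.
  apply: le_trans (linearizer_dist T f s q c L dl q1 q0 q11 c0 L0 dl0 dl1 dlq dlL
    f0 f_ge0 f_lip log_slope0 s_lip b b' _ hx) _.
  rewrite -mulrA ler_wpM2l//; apply: hK' => // k z hz; have /andP[z0 zd] := hz.
    have Iz : unit_itv R z by rewrite unit_itvE z0 (le_trans zd).
    apply: le_trans (fiber_dist _ _ _ Iz) _.
    rewrite mulrC [leRHS]mulrAC [leRHS]mulrC; apply: ler_wpM2l => //.
    have := hW k; have := mulr_ge0 C0 (le_trans (fiber_dist_ge0 _ _) (hW k)).
    by lra.
  apply: le_trans (s_dist _ _ _ hz) _.
  rewrite -/C [leRHS]mulrAC [leLHS]mulrAC; apply: ler_wpM2r => //.
  have := ler_wpM2l C0 (hW k); have := le_trans (fiber_dist_ge0 _ _) (hW k).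
  by lra.
Qed.

End FiberMaps.

(** * The torus *)

Local Open Scope quotient_scope.

Section TorusMetric.
Context {R : realType} {d : nat}.
Implicit Types (x y : 'cV[R]_d) (b : torus R d).

Lemma pi_torusP x y :
  \pi_(torus R d) x = \pi_(torus R d) y <-> forall i, (x i 0 - y i 0) \is a Num.int.
Proof.
split=> [/eqmodP/forallP//|h].
by apply/eqmodP/forallP.
Qed.

Lemma eucl_norm_ge0 x : 0 <= eucl_norm x.
Proof. exact: sqrtr_ge0. Qed.

Lemma coord_le_eucl_norm x i : `|x i 0| <= eucl_norm x.
Proof.
rewrite -sqrtr_sqr /eucl_norm ler_sqrt; last by apply: sumr_ge0 => j _; exact: sqr_ge0.
by rewrite (bigD1 i)//= lerDl sumr_ge0// => j _; exact: sqr_ge0.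
Qed.

(** A crude form of the factor [sqrt d]; the successor keeps it positive, so that it can be divided
    by. *)
Lemma eucl_norm_le x e : (forall i, `|x i 0| <= e) -> 0 <= e ->
  eucl_norm x <= d.+1%:R * e.
Proof.
move=> xe e0; have de0 : 0 <= d.+1%:R * e by rewrite mulr_ge0.
rewrite -(ger0_norm de0) -sqrtr_sqr /eucl_norm ler_sqrt ?sqr_ge0//.
apply: le_trans (_ : \sum_(i < d) e ^+ 2 <= _).
  by apply: ler_sum => i _; rewrite -real_normK ?num_real// ler_pXn2r ?nnegrE.
rewrite sumr_const card_ord -[_ ^+ 2 *+ d]mulr_natl exprMn ler_wpM2r ?sqr_ge0//.
rewrite -natrX ler_nat; apply: leq_trans (leqnSn d) _.
by rewrite -{1}[d.+1]muln1 leq_mul2l.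
Qed.

Let dist_set b b' := [set eucl_norm (x - y) |
  x in [set x | \pi_(torus R d) x = b] & y in [set y | \pi_(torus R d) y = b']].

Let dist_set_has_inf b b' : has_inf (dist_set b b').
Proof.
split.
  exists (eucl_norm (repr b - repr b')).
  by exists (repr b); [rewrite /= reprK|exists (repr b') => //; rewrite /= reprK].
by exists 0 => _ [x _ [y _ <-]]; exact: eucl_norm_ge0.
Qed.

Lemma torus_dist_ge0 b b' : 0 <= torus_dist b b'.
Proof.
apply: lb_le_inf; first by have [] := dist_set_has_inf b b'.
by move=> _ [x _ [y _ <-]]; exact: eucl_norm_ge0.
Qed.

Lemma torus_dist_le x y :
  torus_dist (\pi_(torus R d) x) (\pi_(torus R d) y) <= eucl_norm (x - y).
Proof.
apply: ge_inf; first by have [] := dist_set_has_inf (\pi x) (\pi y).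
by exists x => //; exists y.
Qed.

Lemma torus_dist_adherent b b' e : 0 < e ->
  exists x y, [/\ \pi_(torus R d) x = b, \pi_(torus R d) y = b' &
    eucl_norm (x - y) < torus_dist b b' + e].
Proof.
move=> e0; have [_ [x xb [y yb' <-]] h] := inf_adherent e0 (dist_set_has_inf b b').
by exists x, y.
Qed.

Lemma torus_repr_box b :
  exists2 x, \pi_(torus R d) x = b & forall i, 0 <= x i 0 <= 1.
Proof.
exists (\col_i (repr b i 0 - (Num.floor (repr b i 0))%:~R)).
  rewrite -[RHS]reprK; apply/pi_torusP => i.
  by rewrite mxE addrAC subrr add0r rpredN intr_int.
move=> i; rewrite mxE subr_ge0 ge_floor lerBlDr addrC.
by have := lt_succ_floor (repr b i 0); rewrite intrD => /ltW.
Qed.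

Lemma torus_dist_bounded b b' : torus_dist b b' <= d.+1%:R.
Proof.
have [x <- hx] := torus_repr_box b; have [y <- hy] := torus_repr_box b'.
apply: le_trans (torus_dist_le _ _) _; rewrite -[leRHS]mulr1.
apply: eucl_norm_le => // i; rewrite !mxE ler_norml.
by have /andP[? ?] := hx i; have /andP[? ?] := hy i; apply/andP; split; lra.
Qed.

Lemma entry_le_norm m n (M : 'M[R]_(m, n)) i j : `|M i j| <= `|M|.
Proof.
rewrite [leRHS]/Num.norm /= mx_normrE; apply/bigmax_geP; right => /=.
by exists (i, j).
Qed.

(** The topology is the quotient one, so openness is tested upstairs: the preimage of [O] is the
    union of sup-norm balls around all representatives of [b]. *)
Lemma torus_ball_nbhs b r : 0 < r -> nbhs b [set b' | torus_dist b b' < r].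
Proof.
move=> r0.
pose e := r / (2 * d.+1%:R).
have e0 : 0 < e by rewrite divr_gt0// mulr_gt0.
pose O : set (torus R d) := [set b' | exists x y,
  [/\ \pi_(torus R d) x = b, \pi_(torus R d) y = b' & ball x e y]].
have OP : O `<=` [set b' | torus_dist b b' < r].
  move=> _ [x [y [<- <- xy]]] /=; apply: le_lt_trans (torus_dist_le _ _) _.
  move: xy; rewrite -ball_normE /= => xy.
  apply: le_lt_trans (_ : d.+1%:R * e < _); last first.
    have -> : d.+1%:R * e = r / 2 by rewrite /e; field.
    by lra.
  apply: eucl_norm_le (ltW e0) => i.
  exact: le_trans (entry_le_norm _ _ _ _ _) (ltW xy).
apply: filterS OP _; apply: open_nbhs_nbhs; split; last first.
  by exists (repr b), (repr b); split; rewrite ?reprK//; exact: ballxx.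
have -> : open O = open (\pi_(torus R d) @^-1` O) by [].
have -> : \pi_(torus R d) @^-1` O =
    \bigcup_(x in [set x | \pi_(torus R d) x = b]) ball x e.
  apply/seteqP; split=> [y [x [z [xb zy xz]]]|y [x xb xy]]; last by exists x, y.
  (* [y - z] is a lattice vector, so translating [x] by it gives a representative of [b] close to
     [y] itself. *)
  exists (x + (y - z)).
    rewrite -xb; apply/pi_torusP => i; rewrite !mxE addrAC subrr add0r.
    by move/esym/pi_torusP: zy; exact.
  move: xz; rewrite -!ball_normE /=; by rewrite [y - z]addrC addrA addrK.
by apply: bigcup_open => x _; exact: ball_open.
Qed.

(** Lifted to the compact unit cube, [L] is continuous and attains its minimum; every point of the
    torus has a representative there. *)
Lemma torus_positive_lower_bound (L : torus R d -> R) (C beta : R) :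
  0 <= C -> 0 < beta ->
  (forall b b', `|L b - L b'| <= C * torus_dist b b' `^ beta) ->
  (forall b, 0 < L b) -> exists2 l, 0 < l & forall b, l <= L b.
Proof.
move=> C0 beta0 LC L0.
pose g (v : 'rV[R]_d) := L (\pi_(torus R d) v^T).
pose box := [set v : 'rV[R]_d | forall i, `[0, 1]%classic (v ord0 i)].
have box_compact : compact box.
  by apply: (@rV_compact R d (fun=> `[(0 : R), 1]%classic)) => i; exact: segment_compact.
have box0 : box !=set0 by exists 0 => i /=; rewrite mxE in_itv /= lexx ler01.
have gc : {within box, continuous g}.
  apply: continuous_subspaceT => v.
  apply/(@cvgrPdist_le _ _ _ (nbhs v) (nbhs_filter v)) => e e0.
  pose r := (e / (C + 1)) `^ beta^-1.
  have C1 : 0 < C + 1 by lra.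
  have ec : 0 < e / (C + 1) by exact: divr_gt0.
  have r0 : 0 < r by exact: powR_gt0.
  have rE : r `^ beta = e / (C + 1).
    by rewrite -powRrM mulVf ?gt_eqF// powRr1// ltW.
  apply/nbhs_ballP; exists (r / d.+1%:R); first exact: divr_gt0.
  move=> w; rewrite -ball_normE /= => vw.
  apply: le_trans (LC _ _) _.
  have dr : torus_dist (\pi_(torus R d) v^T) (\pi_(torus R d) w^T) <= r.
    apply: le_trans (torus_dist_le _ _) _.
    have -> : r = d.+1%:R * (r / d.+1%:R) by field.
    apply: eucl_norm_le => [i|]; last by rewrite divr_ge0// ltW.
    rewrite !mxE; have := entry_le_norm _ _ (v - w) 0 i; rewrite !mxE.
    by move=> h; apply: le_trans h (ltW vw).
  have : torus_dist (\pi_(torus R d) v^T) (\pi_(torus R d) w^T) `^ beta <= e / (C + 1).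
    by rewrite -rE ge0_ler_powR ?nnegrE ?torus_dist_ge0// ltW.
  rewrite ler_pdivlMr//; have := powR_ge0 (torus_dist (\pi v^T) (\pi w^T)) beta.
  by nra.
have [c _ cmin] := EVT_min_rV box0 box_compact gc.
exists (g c) => [|b]; first exact: L0.
have [x <- hx] := torus_repr_box b.
have := cmin x^T; rewrite /g trmxK; apply.
by rewrite inE => i /=; rewrite mxE in_itv /=.
Qed.

Lemma iter_torus_map (A : 'M[int]_d) x k :
  iter k (torus_map A) (\pi_(torus R d) x) =
  \pi_(torus R d) (iter k (mulmx (map_mx intr A)) x).
Proof. by elim: k => //= k ->; rewrite torus_mapE. Qed.

Lemma iter_mulmx n p (M : 'M[R]_n) (X : 'M[R]_(n, p)) k :
  iter k (mulmx M) X = iter k (mulmx M) 1%:M *m X.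
Proof. by elim: k => [|k /= ->]; rewrite ?mul1mx// mulmxA. Qed.

(** Lift to representatives that almost realize the distance, apply the matrix power to their
    difference, and let the error [e] tend to 0. *)
Lemma torus_dist_growth (A : 'M[int]_d) (m K : R) : 0 < m -> 0 <= K ->
  (forall k i j, `|iter k (mulmx (map_mx intr A : 'M[R]_d)) 1%:M i j| <= K * m ^+ k) ->
  exists2 K', 0 <= K' & forall k b b',
    torus_dist (iter k (torus_map A) b) (iter k (torus_map A) b')
      <= K' * m ^+ k * torus_dist b b'.
Proof.
move=> m0 K0 AK; exists (d.+1%:R * d%:R * K); first by rewrite !mulr_ge0.
move=> k b b'; set Z := d.+1%:R * d%:R * K * m ^+ k.
have m_ge0 : 0 <= K * m ^+ k by rewrite mulr_ge0// exprn_ge0// ltW.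
have Z0 : 0 <= Z by rewrite /Z -mulrA mulr_ge0// mulr_ge0.
apply/ler_addgt0Pr => e e0.
have e1 : 0 < e / (Z + 1) by rewrite divr_gt0//; lra.
have [x [y [<- <- xy]]] := torus_dist_adherent b b' _ e1.
rewrite !iter_torus_map.
apply: le_trans (torus_dist_le _ _) _.
have -> : iter k (mulmx (map_mx intr A)) x - iter k (mulmx (map_mx intr A)) y =
    iter k (mulmx (map_mx intr A)) 1%:M *m (x - y).
  by rewrite mulmxBr -!iter_mulmx.
apply: le_trans (_ : Z * eucl_norm (x - y) <= _).
  rewrite /Z -2!mulrA mulrA -!mulrA; apply: eucl_norm_le => [i|]; last first.
    by rewrite mulr_ge0// [K * _]mulrA mulr_ge0// eucl_norm_ge0.
  rewrite mxE; apply: le_trans (ler_norm_sum _ _ _) _.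
  apply: le_trans (_ : \sum_(j < d) K * m ^+ k * eucl_norm (x - y) <= _).
    apply: ler_sum => j _; rewrite normrM; apply: ler_pM => //.
    exact: coord_le_eucl_norm.
  by rewrite sumr_const card_ord -[_ *+ d]mulr_natl !mulrA.
have := ler_wpM2l Z0 (ltW xy); rewrite mulrDr => h.
apply: le_trans h _; rewrite lerD2l mulrCA ler_piMr ?(ltW e0)//.
by rewrite ler_pdivrMr; lra.
Qed.

End TorusMetric.

(** * Growth of matrix powers *)

Section MatrixGrowth.

(** [K / (m - mu)] solves [mu * c + K = m * c]. The strict gap [mu < m] absorbs the resonance
    between [z] and the forcing term. *)
Lemma linear_recurrence_growth (F : numFieldType) (a w : nat -> F) (z mu m K K0 : F) :
  0 <= mu -> mu < m -> `|z| <= mu -> `|a 0%N| <= K0 ->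
  (forall k, a k.+1 = z * a k + w k) -> (forall k, `|w k| <= K * m ^+ k) ->
  forall k, `|a k| <= (K0 + K / (m - mu)) * m ^+ k.
Proof.
move=> mu0 mum zmu a0 aS wK.
have K_ge0 : 0 <= K by have := wK 0%N; rewrite expr0 mulr1; apply: le_trans.
have mm : 0 < m - mu by rewrite subr_gt0.
have m0 : 0 <= m by exact: le_trans mu0 (ltW mum).
have c0 : 0 <= K0 + K / (m - mu).
  by rewrite addr_ge0 ?divr_ge0 ?(ltW mm)//; apply: le_trans a0.
elim=> [|k IH].
  by rewrite expr0 mulr1; apply: le_trans a0 _; rewrite lerDl divr_ge0// ltW.
rewrite aS; apply: le_trans (ler_normD _ _) _; rewrite normrM.
apply: le_trans (_ : mu * ((K0 + K / (m - mu)) * m ^+ k) + K * m ^+ k <= _).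
  by apply: lerD => //; apply: ler_pM.
have -> : (K0 + K / (m - mu)) * m ^+ k.+1 =
    mu * ((K0 + K / (m - mu)) * m ^+ k) + K * m ^+ k + K0 * (m - mu) * m ^+ k.
  by rewrite exprS; field; rewrite gt_eqF.
rewrite lerDl !mulr_ge0 ?exprn_ge0 ?(ltW mm)//.
by apply: le_trans a0.
Qed.

(** Replaces the Jordan form: the linear factors of an annihilating polynomial are peeled off one by
    one. The iterates of [M *m X - z *: X] are controlled by induction and are the forcing term in a
    scalar recurrence with coefficient [z] for each entry of the iterates of [X]. *)
Lemma iter_mulmx_growth_annihilated (F : numFieldType) n p (M : 'M[F]_n) (mu m : F)
    (s : seq F) (X : 'M[F]_(n, p)) :
  0 <= mu -> mu < m -> {in s, forall z, `|z| <= mu} ->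
  foldl (fun Y z => M *m Y - z *: Y) X s = 0 ->
  exists2 K, 0 <= K & forall k i j, `|iter k (mulmx M) X i j| <= K * m ^+ k.
Proof.
move=> mu0 mum; elim: s X => [|z s IH] X sm /=.
  move=> ->; exists 0 => // k i j; rewrite mul0r.
  suff -> : iter k (mulmx M) (0 : 'M[F]_(n, p)) = 0 by rewrite mxE normr0.
  by elim: k => //= k ->; rewrite mulmx0.
have zm : `|z| <= mu by apply: sm; rewrite mem_head.
move=> /IH[|K K_ge0 hK].
  by move=> y ys; apply: sm; rewrite inE ys orbT.
pose K0 := \sum_i \sum_j `|X i j|.
have XK i j : `|X i j| <= K0.
  rewrite /K0 (bigD1 i)//= (bigD1 j)//= -addrA lerDl addr_ge0//.
    by rewrite sumr_ge0.
  by rewrite sumr_ge0// => ? _; rewrite sumr_ge0.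
have mm : 0 < m - mu by rewrite subr_gt0.
exists (K0 + K / (m - mu)).
  rewrite addr_ge0 ?divr_ge0 ?(ltW mm)//.
  by rewrite sumr_ge0// => ? _; rewrite sumr_ge0.
move=> k i j.
apply: (linear_recurrence_growth _ (fun k => iter k (mulmx M) X i j)
  (fun k => iter k (mulmx M) (M *m X - z *: X) i j) z) => //.
move=> {}k.
have -> : iter k (mulmx M) (M *m X - z *: X) =
    iter k.+1 (mulmx M) X - z *: iter k (mulmx M) X.
  elim: k => //= k ->; rewrite mulmxBr -scalemxAr//.
have -> (Y Z : 'M[F]_(n, p)) : (Y - z *: Z) i j = Y i j - z * Z i j by rewrite !mxE.
by rewrite addrC subrK.
Qed.

Lemma foldl_horner_mx (F : fieldType) n (M X : 'M[F]_n.+1) (s : seq F) :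
  foldl (fun Y z => M *m Y - z *: Y) X s =
  horner_mx M (\prod_(z <- s) ('X - z%:P)) *m X.
Proof.
elim: s X => [|z s IH] X /=; first by rewrite big_nil rmorph1 mul1mx.
rewrite IH big_cons mulrC rmorphM /= -mulmxE -mulmxA; congr (_ *m _).
by rewrite rmorphB /= horner_mx_X horner_mx_C mulmxBl mul_scalar_mx.
Qed.

Lemma eigenvalue_bound_growth (F : numClosedFieldType) n (M : 'M[F]_n) (mu m : F) :
  0 <= mu -> mu < m -> (forall z, eigenvalue M z -> `|z| <= mu) ->
  exists2 K, 0 <= K & forall k i j, `|iter k (mulmx M) 1%:M i j| <= K * m ^+ k.
Proof.
case: n M => [|n] M mu0 mum eM; first by exists 0 => // k [].
have [s sE] := closed_field_poly_normal (char_poly M).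
rewrite (monicP (char_poly_monic M)) scale1r in sE.
apply: (iter_mulmx_growth_annihilated _ _ _ M mu m s) => //.
  by move=> z zs; apply: eM; rewrite eigenvalue_root_char sE root_prod_XsubC.
by rewrite foldl_horner_mx -sE Cayley_Hamilton mul0mx.
Qed.

Lemma max_eigenvalue_growth (R : realType) d (A : 'M[int]_d) (mu m : R) :
  is_max_eigenvalue_modulus A mu -> mu < m ->
  exists2 K : R, 0 <= K & forall k i j,
    `|iter k (mulmx (map_mx intr A : 'M[R]_d)) 1%:M i j| <= K * m ^+ k.
Proof.
move=> [[z0 _ z0mu] eA] mum.
have mu0 : 0 <= (mu%:C)%C by rewrite -z0mu.
have [|K K0 hK] := eigenvalue_bound_growth _ _ _ _ (m%:C)%C mu0 _ eA.
  by rewrite ltcR.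
(* A complex number that is nonnegative for the order is real, so nothing is lost. *)
exists (complex.Re K); first by move: K0; rewrite lecE => /andP[].
move=> k i j; have := hK k i j.
have -> : iter k (mulmx (complex_mx R A)) 1%:M =
    map_mx (real_complex R) (iter k (mulmx (map_mx intr A : 'M[R]_d)) 1%:M).
  elim: k => [|k /= ->]; first by rewrite map_mx1.
  rewrite map_mxM; congr (_ *m _); apply/matrixP => a b.
  by rewrite !mxE rmorph_int.
rewrite mxE normc_def /= expr0n addr0 sqrtr_sqr.
by rewrite -[K](RRe_real (ger0_real K0)) -rmorphXn -rmorphM lecR.
Qed.

End MatrixGrowth.

(** * Exponents and continuity *)

(** On a bounded set the exponent can be lowered: [beta - alpha] powers of [x] are spent on the
    bound [m], the remaining [alpha] on [K * D]. *)
Lemma powR_exponent_split (R : realType) (x m K D alpha beta : R) :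
  0 <= x -> 0 <= D -> 0 < alpha <= beta -> x <= m -> x <= K * D -> 0 <= K ->
  x `^ beta <= m `^ (beta - alpha) * K `^ alpha * D `^ alpha.
Proof.
move=> x0 D0 /andP[a0 ab] xm xK K0.
have -> : beta = beta - alpha + alpha by rewrite subrK.
rewrite powRD; last by rewrite subrK; apply/implyP; rewrite gt_eqF// (lt_le_trans a0).
rewrite addrK -mulrA -powRM//; apply: ler_pM; rewrite ?powR_ge0//.
  by apply: ge0_ler_powR; rewrite ?nnegrE ?subr_ge0// (le_trans x0).
by apply: ge0_ler_powR; rewrite ?nnegrE ?mulr_ge0// ltW.
Qed.

Lemma critical_exponent_rate (R : realType) (mu q alpha : R) : 0 < q < 1 ->
  0 < alpha < - log_base mu q ->
  exists m nu, [/\ mu < m, 1 < nu, q * nu < 1 & m `^ alpha <= nu].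
Proof.
move=> /andP[q0 q1] /andP[a0 a1].
have lq : ln q < 0 by rewrite ln_lt0// q0.
have lmu : 0 < ln mu.
  (* Were [ln mu <= 0], then [log_base mu q >= 0] (with [ln q / 0 = 0] in the degenerate case),
     leaving no room for [alpha > 0]. *)
  rewrite ltNge; apply/negP => lmu; move: a1; apply/negP; rewrite -leNgt.
  apply: le_trans (ltW a0); rewrite oppr_le0 /log_base.
  by rewrite -[ln q / _]mulrNN -invrN divr_ge0// oppr_ge0// ltW.
have mu1 : 1 < mu by rewrite ltNge; apply: contraTN lmu => /ln_le0; rewrite leNgt.
have mu0 : 0 < mu by apply: lt_trans mu1.
have aq : alpha * ln mu < - ln q.
  by move: a1; rewrite /log_base -mulNr ltr_pdivlMr.
have mua : mu `^ alpha < q^-1.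
  by rewrite /powR gt_eqF// -[q^-1]lnK ?posrE ?invr_gt0// ltr_expR lnV ?posrE.
have mua1 : 1 < mu `^ alpha.
  by rewrite /powR gt_eqF// -[X in X < _]expR0 ltr_expR mulr_gt0.
(* Midpoint of the window opened by [alpha < - log_base mu q]; [m] is then its [alpha]-th root. *)
pose nu := (mu `^ alpha + q^-1) / 2.
have nu1 : mu `^ alpha < nu by rewrite /nu; lra.
exists (nu `^ alpha^-1), nu; split.
- have -> : mu = (mu `^ alpha) `^ alpha^-1.
    by rewrite -powRrM divff ?gt_eqF// powRr1// ltW.
  by apply: gt0_ltr_powR; rewrite ?nnegrE ?invr_gt0 ?powR_ge0//; lra.
- exact: lt_trans nu1.
- have : nu < q^-1 by rewrite /nu; lra.
  by rewrite -(ltr_pM2l q0) divff ?gt_eqF.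
- by rewrite -powRrM mulVf ?gt_eqF// powRr1//; lra.
Qed.

(** Supplies the exponent for the continuity of [H]. Any [m > 1] above [mu] will do, since [m]
    raised to a small enough power falls below a [nu] between 1 and [q^-1]. *)
Lemma small_exponent_rate (R : realType) (mu q beta : R) : 0 < q < 1 -> 0 < beta ->
  exists alpha m nu, [/\ 0 < alpha <= beta, mu < m, 1 < nu, q * nu < 1 & m `^ alpha <= nu].
Proof.
move=> /andP[q0 q1] b0.
pose nu := (1 + q^-1) / 2; pose m := `|mu| + 2.
have qi : 1 < q^-1 by rewrite invf_gt1.
have nu1 : 1 < nu by rewrite /nu; lra.
have nu0 : 0 < nu by lra.
have m1 : 1 < m by rewrite /m; have := normr_ge0 mu; lra.
have m0 : 0 < m by lra.
have lm : 0 < ln m by rewrite ln_gt0.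
have a0 : 0 < ln nu / ln m by rewrite divr_gt0// ln_gt0.
exists (Num.min beta (ln nu / ln m)), m, nu; split => //.
- by rewrite lt_min b0 a0 ge_min lexx.
- by rewrite /m; have := ler_norm mu; lra.
- have : nu < q^-1 by rewrite /nu; lra.
  by rewrite -(ltr_pM2l q0) divff ?gt_eqF.
- rewrite /powR gt_eqF// -[leRHS]lnK ?posrE// ler_expR.
  by rewrite -ler_pdivlMr// ge_min lexx orbT.
Qed.

Lemma fiberwise_continuous (R : realType) d (k : torus R d -> R -> R) (P : set R)
    (C alpha : R) : 0 < alpha -> 0 <= C ->
  (forall b b' x x', P x -> P x' ->
     `|k b x - k b' x'| <= C * (`|x - x'| + torus_dist b b' `^ alpha)) ->
  {within [set p : torus R d * R | P p.2], continuous (fun p => (p.1, k p.1 p.2))}.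
Proof.
move=> a0 C0 kC; apply/subspace_continuousP => -[b x] /= Px.
have C1 : 0 < 2 * (C + 1) by lra.
move=> U [[V Z] /= [bV kZ] VZ].
have /nbhs_ballP[e /= e0 eZ] := kZ.
have ec : 0 < e / (2 * (C + 1)) by exact: divr_gt0.
pose r := (e / (2 * (C + 1))) `^ alpha^-1.
exists (V `&` [set b' | torus_dist b b' < r], ball x (e / (2 * (C + 1)))) => /=.
  split; last exact: nbhsx_ballx.
  by apply: filterI => //; apply: torus_ball_nbhs; exact: powR_gt0.
move=> [b' x'] /= [[Vb' br]]; rewrite -ball_normE /= => xr Px'.
apply: VZ; split => //=; apply: eZ; rewrite -ball_normE /=.
apply: le_lt_trans (kC _ _ _ _ Px Px') _.
have : torus_dist b b' `^ alpha <= e / (2 * (C + 1)).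
  have -> : e / (2 * (C + 1)) = r `^ alpha.
    by rewrite /r -powRrM mulVf ?gt_eqF// powRr1// ltW.
  by apply: ge0_ler_powR; rewrite ?nnegrE ?torus_dist_ge0 ?powR_ge0// ltW.
move: xr; rewrite ltr_pdivlMr// ler_pdivlMr//.
have := normr_ge0 (x - x'); have := powR_ge0 (torus_dist b b') alpha.
nra.
Qed.

(** * Conjugacy over the hyperbolic torus automorphism *)

Theorem theorem2 (R : realType) (d : nat) (hd : (0 < d)%N)
    (A : 'M[int]_d) (f : torus R d -> R -> R)
    (hF : boundary_preserving A f)
    (hC2 : forall b, class_C 2 (unit_itv R) (f b))
    (C2 beta : R) (hC2pos : 0 < C2) (hbeta : 0 < beta)
    (hHolder : forall b b' : torus R d,
       (C2_norm (unit_itv R) (fun x => (f b x - f b' x)%R)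
          <= (C2 * torus_dist b b' `^ beta)%:E)%E)
    (mu : R) (hmu : is_max_eigenvalue_modulus A mu)
    (q : R) (hq : forall b, fiber_multiplier f b <= q) (hq1 : q < 1) :
  exists (eps : R) (H : torus R d * R -> torus R d * R) (h : torus R d -> R -> R),
    [/\ 0 < eps <= 1,
        homeo_onto_image (strip d eps) H /\
          H @` strip d eps `<=` phase_space R d,
        forall b x, strip d eps (b, x) -> H (b, x) = (b, x + h b x),
        forall b, [/\ h b 0 = 0, is_derive_within `[0, eps] (h b) 0 0
          & {within `[0, eps], continuous (h b)}] &
        (forall p, strip d eps p ->
           skew_product A f (H p) = H (skew_product A (linearization f) p)) /\
        forall alpha : R, 0 < alpha < Num.min beta (- log_base mu q) ->
          exists2 C0 : R, 0 < C0 &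
            forall b b' : torus R d,
              (sup_norm `[0%R, eps] (fun x => (h b x - h b' x)%R)
                 <= (C0 * torus_dist b b' `^ alpha)%:E)%E].
Proof.
have [Ahyp fb] := hF.
pose b0 : torus R d := (\pi_(torus R d) 0)%qT.
pose W (b b' : torus R d) := C2 * torus_dist b b' `^ beta.
have f0 b : f b 0 = 0 by have [] := fb b.
have fI b x : unit_itv R x -> 0 <= f b x.
  have [[fS _ _ _] _ _] := fb b.
  by move=> /fS; rewrite unit_itvE => /andP[].
have lam_gt0 b : 0 < fiber_multiplier f b.
  by have [fd _ _] := fb b; exact: diffeo_multiplier_gt0.
have Wle b b' : W b b' <= C2 * d.+1%:R `^ beta.
  rewrite ler_wpM2l ?(ltW hC2pos)//; apply: ge0_ler_powR; rewrite ?(ltW hbeta) ?nnegrE//.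
    exact: torus_dist_ge0.
  exact: torus_dist_bounded.
have lamW b b' : `|fiber_multiplier f b - fiber_multiplier f b'| <= W b b'.
  apply: (fiber_derive_dist f W hC2 hHolder).
  by rewrite unit_itvE lexx ler01.
have [l l0 lam_ge] := torus_positive_lower_bound _ _ _ (ltW hC2pos) hbeta lamW lam_gt0.
have lam_bound b : l <= fiber_multiplier f b <= q by rewrite lam_ge hq.
have q0 : 0 < q by apply: lt_le_trans (hq b0).
have q01 : 0 < q < 1 by rewrite q0.
have [dl [eps [K [Phi [G [[dlP epsP K0] PhiL GP PhiD]]]]]] :=
  nonstationary_linearization (torus_map A) f W b0 _ hC2 f0 fI hHolder Wle q l
    l0 hq1 lam_bound.
have /andP[dl0 dl1] := dlP; have /andP[eps0 epsd] := epsP.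
have PhiH alpha m nu : 0 < alpha <= beta -> mu < m -> 1 < nu -> q * nu < 1 ->
    m `^ alpha <= nu -> exists2 C, 0 <= C & forall b b' x, 0 <= x <= dl ->
      `|Phi b x - Phi b' x| <= C * torus_dist b b' `^ alpha.
  move=> ab mum nu1 qnu mnu; have /andP[a0 aleb] := ab.
  have mu0 : 0 <= mu.
    have [[z _ zE] _] := hmu; have : 0 <= (mu%:C)%C by rewrite -zE.
    by rewrite lecE => /andP[].
  have m0 : 0 < m by exact: le_lt_trans mum.
  have [K1 K10 AK] := max_eigenvalue_growth _ _ _ _ _ hmu mum.
  have [K2 K20 TK] := torus_dist_growth _ _ _ m0 K10 AK.
  pose K3 := C2 * (d.+1%:R `^ (beta - alpha) * K2 `^ alpha).
  have K30 : 0 <= K3 by rewrite !mulr_ge0 ?powR_ge0// ltW.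
  have [C C0 hC] := PhiD nu K3 nu1 qnu K30.
  exists C => // b b' x hx; apply: hC => //; first exact: powR_ge0.
  move=> k; rewrite /W /K3 -mulrA ler_wpM2l ?(ltW hC2pos)//.
  have h : torus_dist (iter k (torus_map A) b) (iter k (torus_map A) b') <=
      K2 * (m ^+ k * torus_dist b b') by rewrite mulrA.
  have mk0 : 0 <= m ^+ k by rewrite exprn_ge0// ltW.
  apply: le_trans (powR_exponent_split _ _ d.+1%:R _ _ _ _ (torus_dist_ge0 _ _) _ ab
    (torus_dist_bounded _ _) h K20) _.
    by rewrite mulr_ge0// torus_dist_ge0.
  rewrite ler_wpM2l ?mulr_ge0 ?powR_ge0// powRM ?torus_dist_ge0//.
  rewrite ler_wpM2r ?powR_ge0//.
  rewrite -[m ^+ k]powR_mulrn ?(ltW m0)// powRAC powR_mulrn ?powR_ge0//.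
  by apply: lerXn2r; rewrite ?nnegrE ?powR_ge0//; apply: le_trans mnu; exact: powR_ge0.
(* Apply [Phi b] to both points: it sends [G b x] to [x], while at [G b' x'] it differs from
   [Phi b'], whose value there is [x'], by the Hoelder term. The factor 4 is the expansion bound. *)
have GH alpha C : 0 <= C -> (forall b b' x, 0 <= x <= dl ->
      `|Phi b x - Phi b' x| <= C * torus_dist b b' `^ alpha) ->
    forall b b' x x', 0 <= x <= eps -> 0 <= x' <= eps ->
      `|G b x - G b' x'| <= 4 * (`|x - x'| + C * torus_dist b b' `^ alpha).
  move=> C0 hC b b' x x' hx hx'.
  have [hG PG _ _] := GP b x hx; have [hG' PG' _ _] := GP b' x' hx'.
  apply: le_trans (PhiL b _ _ hG hG').2 _; rewrite ler_wpM2l// PG -PG'.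
  apply: le_trans (ler_distD (Phi b' (G b' x')) _ _) _; rewrite PG' lerD2l.
  by rewrite -[X in `|X - _|]PG' distrC; exact: hC.
have G0 b : G b 0 = 0.
  have [|_ _ + _] := GP b 0; first by rewrite lexx ltW.
  by rewrite expr0n mulr0 subr0 normr_le0 => /eqP.
have stripE b x : strip d eps (b, x) = (0 <= x <= eps) :> Prop.
  rewrite /strip /= unit_itvE in_itv /=; apply/propext; split=> [[]//|h].
  split => //; have /andP[-> h2] := h.
  by apply: le_trans h2 _; apply: le_trans epsd _.
have [alpha0 [m0 [nu0 [ab0 mm0 nu01 qnu0 mnu0]]]] := small_exponent_rate _ mu _ _ q01 hbeta.
have [C0 C0_ge0 hC0] := PhiH _ _ _ ab0 mm0 nu01 qnu0 mnu0.
have a00 : 0 < alpha0 by case/andP: ab0.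
exists eps, (fun p => (p.1, G p.1 p.2)), (fun b x => G b x - x); split.
- by rewrite eps0 (le_trans epsd).
- split; last first.
    move=> _ [[b x] /= hx <-]; rewrite /phase_space /= unit_itvE.
    move: hx; rewrite stripE => /(GP b)[/andP[-> h] _ _ _].
    exact: le_trans dl1.
  split.
    apply: (@continuous_subspaceW _ _ _ [set p | 0 <= p.2 <= eps]).
      by move=> [b x]; rewrite stripE.
    apply: (fiberwise_continuous R d G [set x | 0 <= x <= eps] (4 * (1 + C0)) alpha0) => //.
      by rewrite mulr_ge0// addr_ge0.
    move=> b b' x x' hx hx'; apply: le_trans (GH _ _ C0_ge0 hC0 b b' _ _ hx hx') _.
    have := normr_ge0 (x - x'); have := powR_ge0 (torus_dist b b') alpha0.
    by nra.
  (* The inverse of [H] is [Phi] on each fiber, continuous on the strip of width [dl] that contains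
     the image. *)
  exists (fun p => (p.1, Phi p.1 p.2)); split.
    apply: (@continuous_subspaceW _ _ _ [set p | 0 <= p.2 <= dl]).
      by move=> _ [[b x] /= hx <-] /=; move: hx; rewrite stripE => /(GP b)[].
    apply: (fiberwise_continuous R d Phi [set x | 0 <= x <= dl] (4 + C0) alpha0) => //.
      by rewrite addr_ge0.
    move=> b b' x x' hx hx'.
    apply: le_trans (ler_distD (Phi b x') _ _) _.
    have := (PhiL b _ _ hx hx').1; have := hC0 b b' _ hx'.
    have := normr_ge0 (x - x'); have := powR_ge0 (torus_dist b b') alpha0.
    by nra.
  by move=> [b x]; rewrite inE stripE => /(GP b)[_ e _ _] /=; rewrite e.
- by move=> b x _ /=; rewrite addrC subrK.
- move=> b; split; first by rewrite G0 subr0.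
    apply/is_derive_withinP => e e0.
    (* The difference quotient of [h b] at 0 is at most [K * y] by the quadratic estimate. *)
    exists (e / (K + 1)); first by rewrite divr_gt0//; lra.
    move=> y /=; rewrite in_itv /= => hy y0; rewrite !subr0 G0 !subr0.
    have [_ _ h _] := GP b y hy; have /andP[y_ge0 _] := hy.
    have yp : 0 < y by rewrite lt_neqAle eq_sym y0.
    rewrite (gtr0_norm yp) ltr_pdivlMr; last by lra.
    move=> hye; rewrite normrM normfV (gtr0_norm yp) ler_pdivrMr//.
    by apply: le_trans h _; rewrite expr2 mulrA ler_wpM2r//; nra.
  apply: (within_continuous_modulus _ _ _ 5) => x y /=; rewrite !in_itv /= => hx hy.
  have [hG PG _ _] := GP b x hx; have [hG' PG' _ _] := GP b y hy.
  have := (PhiL b _ _ hG hG').2; rewrite PG PG' => h.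
  have -> : G b x - x - (G b y - y) = (G b x - G b y) - (x - y) by ring.
  by apply: le_trans (ler_normB _ _) _; lra.
- split.
    move=> [b x]; rewrite stripE => /(GP b)[_ _ _ e].
    by rewrite /skew_product /= e.
  move=> alpha /andP[a0]; rewrite lt_min => /andP[ab aq].
  have [|m [nu [mum nu1 qnu mnu]]] := critical_exponent_rate _ mu _ alpha q01.
    by rewrite a0.
  have [|C C_ge0 hC] := PhiH alpha m nu _ mum nu1 qnu mnu.
    by rewrite a0 ltW.
  exists (4 * C + 1) => [|b b']; first by rewrite ltr_wpDl// mulr_ge0.
  apply/ereal_supP => _ [x /= + <-]; rewrite in_itv /= => hx.
  rewrite lee_fin; have := GH _ _ C_ge0 hC b b' _ _ hx hx.
  have -> : G b x - x - (G b' x - x) = G b x - G b' x by ring.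
  rewrite subrr normr0 add0r => /le_trans; apply.
  by have := powR_ge0 (torus_dist b b') alpha; nra.
Qed.
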